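(* Let $A:=(V,m_2)$ be a strictly graded commutative algebra and let $m$ and $m'$ be two minimal $C_{n+1}$-structures ($n\ge3$) on $V$ whose underlying algebra is $A$. Then the assignment sending a pointed $C_n$-morphism $\phi$ from $\bar m$ to $\bar m'$ to the vector field of order $n$ and degree one $\mathrm{obs}(\phi):=\phi\circ m\circ\phi^{-1}-m'\mod(n+1)$ induces a map $$\mathrm{obs}_n:\mathcal M_n(\bar m;\bar m')\to H^{n,2}_{\mathrm{Harr}}(A,A),\qquad\phi\mapsto\mathrm{obs}(\phi).$$ The kernel of this map (the preimage of $0$) consists of precisely those $C_n$-morphisms which are extendable: $$\{\phi\in\mathcal M_n(\bar m;\bar m'):\phi\text{ is extendable}\}=\ker(\mathrm{obs}_n).$$
   Context: Conventions. $\mathbb K$ is an evenly graded commutative ring containing $\mathbb Q$; modules are graded $\mathbb K$-modules, cohomologically graded, with the Koszul sign rule. $(\Sigma V)^i=V^{i+1}$, $(\Sigma^{-1}V)^i=V^{i-1}$; $\Sigma V^*$ means $\mathrm{Hom}_{\mathbb K}(\Sigma V,\mathbb K)$. Profinite modules are inverse limits of free modules of finite rank. For $W$ profinite, $\widehat TW=\prod_{i\ge0}W^{\hat\otimes i}$ and $\widehat LW\subset\widehat TW$ is the Lie subalgebra of convergent (possibly infinite) linear combinations of Lie monomials. Vector field = continuous derivation; diffeomorphism = invertible continuous homomorphism; $\mathrm{Der}(X)$, $\mathrm{Aut}(X)$ are the Lie algebra and group of these. Elements of $W^{\hat\otimes n}$ have order $n$; an endomorphism of $\widehat LW$ has order $n$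 if it takes elements of order $i$ to elements of order $i+n-1$. $(n)$ denotes the module of continuous endomorphisms of $\widehat L\Sigma V^*$ of order $\ge n$. A diffeomorphism is pointed if it is of the form $\mathrm{id}+\phi_2+\phi_3+\cdots$ with $\phi_i$ an endomorphism of order $i$. Minimal $C_n$-structures. Let $V$ be a free graded module, $n\ge3$. A minimal $C_n$-structure on $V$ is a vector field $m\in\mathrm{Der}(\widehat L\Sigma V^* )$ of degree one of the form $m=m_2+\dots+m_{n-1}$, $m_i$ of order $i$, with $m^2=0\mod(n+1)$. Its part $m_2$ determines a strictly graded commutative algebra $(V,m_2)$, the underlying algebra; conversely strictly graded commutative algebra structures on $V$ are given by vector fields $m_2$ of order 2 and degree one with $m_2^2=0$. For a minimal $C_{n+1}$-structure $m=m_2+\dots+m_n$, $\bar m:=m_2+\dots+m_{n-1}$ is the corresponding $C_n$-structure. Morphisms. A minimal $C_n$-morphism from $m$ to $m'$ (minimal $C_n$-structures on $V$) is a diffeomorphism $\phi\in\mathrm{Aut}(\widehat L\Sigma V^* )$ of degree zero with $\phi\circ m=m'\circ\phi\mod(n)$. Two such morphisms $\phi,\phi'$ are homotopic if there is a vector field $\eta$ of degree $-1$ with $\phi=\phi'\circ\exp([m,\eta])\mod(n-1)$. $\mathcal M_n(m;m')$, for $m,m'$ with the same underlying algebra, is the set of pointed minimal $C_n$-morphisms from $m$ to $m'$ modulo homotopy. For minimal $C_{n+1}$-structures $m,m'$ with the same underlying algebra, a pointed $C_n$-morphism $\phi$ from $\bar m$ to $\bar m'$ is extendable if there is a vector field $\gamma$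 of order $n-1$ and degree zero such that $\exp(\gamma)\circ\phi$ is a $C_{n+1}$-morphism from $m$ to $m'$. Harrison cohomology. $C^\bullet_{\mathrm{Harr}}(A,A)=\Sigma^{-1}\mathrm{Der}(\widehat L\Sigma V^* )$ with differential $\xi\mapsto[m_2,\xi]$; $\xi$ has bidegree $(i,j)$ if it is a vector field of order $i$ and has degree $j$ in $\Sigma^{-1}\mathrm{Der}$ (i.e. degree $j-1$ as a vector field). The differential has bidegree $(1,1)$, and $H^{ij}_{\mathrm{Harr}}(A,A)$ is the resulting bigraded cohomology. *)

(* Defs.v *)
From HB Require Import structures.
From mathcomp Require Import all_boot all_order all_algebra.
From mathcomp Require Import all_classical.
From mathcomp Require Import zify ring.
From Stdlib Require Relation_Operators.
Set Implicit Arguments.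
Unset Strict Implicit.
Unset Printing Implicit Defensive.

Import GRing.Theory.
Local Open Scope classical_set_scope.
Local Open Scope ring_scope.

(* An even grading K = (+)_d K^d of a commutative ring containing Q. *)
Record even_grading (K : comAlgType rat) := EvenGrading {
  gr_piece :> int -> set K;
  gr_piece0 : forall d, gr_piece d 0;
  gr_pieceB : forall d a b, gr_piece d a -> gr_piece d b -> gr_piece d (a - b);
  gr_piece1 : gr_piece 0 1;
  gr_pieceM : forall d e a b,
    gr_piece d a -> gr_piece e b -> gr_piece (d + e) (a * b);
  gr_decomp : forall a, exists (s : seq int) (c : int -> K),
    (forall d, gr_piece d (c d)) /\ a = \sum_(d <- s) c d;
  gr_direct : forall (s : seq int) (c : int -> K), uniq s ->
    (forall d, gr_piece d (c d)) -> \sum_(d <- s) c d = 0 ->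
    forall d, d \in s -> c d = 0;
  gr_even : forall d a, odd `|d|%N -> gr_piece d a -> a = 0
}.

(* A free graded module, presented by a homogeneous basis (e_i) of arbitrary
   cardinality; bdeg i is the degree of e_i in V. *)
Record free_graded := FreeGraded {
  basis : choiceType;
  bdeg : basis -> int
}.

(* The functional x_i in Sigma V^* = Hom(Sigma V, K) dual to e_i has degree
   1 - bdeg i: e_i has degree bdeg i - 1 in Sigma V.  An element of the
   completed tensor algebra on Sigma V^* is a formal series sum_w f_w x_w with
   w ranging over words in the basis: such series of word length n form the
   profinite module (Sigma V^* )^{\hat\otimes n} = Hom((Sigma V)^{\otimes n}, K). *)
Definition word (V : free_graded) := seq (basis V).
Definition wdeg (V : free_graded) (w : word V) : int :=
  \sum_(i <- w) (1 - bdeg i).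
Definition series (K : comAlgType rat) (V : free_graded) := word V -> K^o.

(* Iterated brackets of the generators x_i. *)
Inductive lie_tree (V : free_graded) :=
  | Leaf of basis V
  | Node of lie_tree V & lie_tree V.

HB.instance Definition _ V := gen_eqMixin (lie_tree V).
HB.instance Definition _ V := gen_choiceMixin (lie_tree V).

Section LieSeries.
Variables (K : comAlgType rat) (V : free_graded).
Implicit Types (f g : series K V) (w u : word V) (t : lie_tree V).

(* The graded commutator fg - (-1)^(|f||g|) gf, extended bilinearly to
   inhomogeneous series.  Since K is even, the parity of |f| is that of wdeg u
   whenever f u != 0, so the sign can be read off the words. *)
Definition sbracket f g : series K V := fun w =>
  \sum_(k < (size w).+1)
     (f (take k w) * g (drop k w)
      - (-1) ^+ `|(wdeg (take k w) * wdeg (drop k w))%R|%N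
          * (g (take k w) * f (drop k w))).

Fixpoint lie_monomial t : series K V :=
  match t with
  | Leaf i => fun w => (w == [:: i])%:R
  | Node t1 t2 => sbracket (lie_monomial t1) (lie_monomial t2)
  end.

(* Convergent, possibly infinite, linear combinations of Lie monomials.  Every
   family of coefficients converges: see lie_monomial_finite below. *)
Definition lie_series f : Prop :=
  exists c : lie_tree V -> K,
    forall w, f w = \sum_(t \in [set: lie_tree V]) (c t * lie_monomial t w).

Fixpoint nleaves t : nat :=
  match t with Leaf _ => 1 | Node a b => (nleaves a + nleaves b)%N end.
Fixpoint leaves t : word V :=
  match t with Leaf i => [:: i] | Node a b => leaves a ++ leaves b end.

Lemma nleaves_gt0 t : (0 < nleaves t)%N.
Proof. by elim: t => //= a a0 b b0; rewrite addn_gt0 a0. Qed.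

Lemma lie_monomial_supp t w : lie_monomial t w != 0 ->
  size w = nleaves t /\ {subset leaves t <= w}.
Proof.
elim: t w => [i|a IHa b IHb] w /=.
  case: (w =P [:: i]) => [-> _|_]; first by split.
  by rewrite mulr0n eqxx.
move=> nz.
have [k] : exists k : 'I_(size w).+1,
  lie_monomial a (take k w) * lie_monomial b (drop k w) != 0 \/
  lie_monomial b (take k w) * lie_monomial a (drop k w) != 0.
  apply: contrapT => H; move/eqP: nz; apply.
  rewrite /sbracket big1 // => k _.
  have [->|n1] := eqVneq (lie_monomial a (take k w) * lie_monomial b (drop k w)) 0.
    have [->|n2] := eqVneq (lie_monomial b (take k w) * lie_monomial a (drop k w)) 0.
      by rewrite mulr0 subr0.
    by case: H; exists k; right.
  by case: H; exists k; left.
have nzM (x y : K) : x * y != 0 -> x != 0 /\ y != 0.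
  by move=> xy; split; apply: contraNneq xy => ->; rewrite ?mul0r ?mulr0.
have sz := size_cat (take k w) (drop k w); rewrite cat_take_drop in sz.
by case=> /nzM [] => [/IHa [sa la] /IHb [sb lb]|/IHb [sb lb] /IHa [sa la]];
  (split; first lia) => x; rewrite mem_cat -(cat_take_drop k w) mem_cat;
  case/orP => [/la|/lb] ->; rewrite ?orbT.
Qed.

Fixpoint trees_over (k : nat) w : seq (lie_tree V) :=
  if k is k'.+1 then
    map (@Leaf V) w ++ [seq Node a b | a <- trees_over k' w, b <- trees_over k' w]
  else [::].

Lemma mem_trees_over k w t :
  (nleaves t <= k)%N -> {subset leaves t <= w} -> t \in trees_over k w.
Proof.
elim: t k => [i|a IHa b IHb] [|k] //=.
- by move=> _ sub; rewrite mem_cat map_f // sub // inE.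
- by have := nleaves_gt0 a; lia.
- move=> le sub; rewrite mem_cat; apply/orP; right.
  have := nleaves_gt0 a; have := nleaves_gt0 b => b0 a0.
  apply: allpairs_f; [apply: IHa|apply: IHb]; try lia.
    by move=> x xa; apply: sub; rewrite mem_cat xa.
  by move=> x xa; apply: sub; rewrite mem_cat xa orbT.
Qed.

Lemma lie_sum_seq (c : lie_tree V -> K) w (r : seq (lie_tree V)) : uniq r ->
  (forall t, c t * lie_monomial t w != 0 -> t \in r) ->
  \sum_(t \in [set: lie_tree V]) (c t * lie_monomial t w)
  = \sum_(t <- r) (c t * lie_monomial t w).
Proof.
move=> ur sub; rewrite (fsbigE r) //; last first.
  by move=> t _ tr; apply/eqP; apply: contraNT tr => /sub.
by apply: eq_bigl => t; rewrite in_setT.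
Qed.

Lemma lie_monomial_finite w :
  finite_set [set t | lie_monomial t w != 0].
Proof.
apply: (sub_finite_set (B := [set` trees_over (size w) w])) => //= t /=.
by move=> /lie_monomial_supp [s sub]; apply: mem_trees_over; rewrite ?s.
Qed.

Lemma trees_over_supp w w' t : (size w' <= size w)%N -> {subset w' <= w} ->
  lie_monomial t w' != 0 -> t \in undup (trees_over (size w) w).
Proof.
move=> sz sub /lie_monomial_supp [s lt]; rewrite mem_undup.
by apply: mem_trees_over; [rewrite -s|move=> x /lt /sub].
Qed.

Lemma lie_sumE (c : lie_tree V -> K) w w' :
  (size w' <= size w)%N -> {subset w' <= w} ->
  \sum_(t \in [set: lie_tree V]) (c t * lie_monomial t w')
  = \sum_(t <- undup (trees_over (size w) w)) (c t * lie_monomial t w').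
Proof.
move=> sz sub; apply: lie_sum_seq; first exact: undup_uniq.
move=> t nz; apply: (trees_over_supp (w' := w')) => //.
by apply: contraNneq nz => ->; rewrite mulr0.
Qed.

Definition lie_pred : {pred series K V} := fun f => `[< lie_series f >].

Lemma lie_pred_submod : submod_closed lie_pred.
Proof.
split.
  apply/asboolP; exists (fun _ => 0) => w.
  by rewrite (lie_sumE _ (w := w)) // big1 // => t _; rewrite mul0r.
move=> a f g /asboolP [c cf] /asboolP [d dg]; apply/asboolP.
exists (fun t => a * c t + d t) => w.
rewrite (lie_sumE _ (w := w)) //.
have -> : (a *: f + g) w = a * f w + g w by [].
rewrite cf dg !(lie_sumE _ (w := w)) // mulr_sumr -big_split /=.
by apply: eq_bigr => t _; rewrite mulrDl mulrA.
Qed.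

Lemma lie_series_bracket f g :
  lie_series f -> lie_series g -> lie_series (sbracket f g).
Proof.
move=> [c cf] [d dg].
exists (fun t => if t is Node a b then c a * d b else 0) => w.
set R := undup (trees_over (size w) w).
have subt k : {subset take k w <= w} by move=> x /mem_take.
have subd k : {subset drop k w <= w} by move=> x /mem_drop.
have szt k : (size (take k w) <= size w)%N by rewrite size_take_min geq_minr.
have szd k : (size (drop k w) <= size w)%N by rewrite size_drop leq_subr.
rewrite (lie_sum_seq (r := [seq Node a b | a <- R, b <- R])); first last.
- case=> [i|a b]; first by rewrite mul0r eqxx.
  move=> nz; have /lie_monomial_supp [s sub] : lie_monomial (Node a b) w != 0.
    by apply: contraNneq nz => ->; rewrite mulr0.
  move: s sub => /= s sub.
  by apply: allpairs_f; rewrite mem_undup; apply: mem_trees_over; rewrite ?s;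
    try lia; move=> x xa; apply: sub; rewrite mem_cat xa ?orbT.
- by apply: allpairs_uniq; rewrite ?undup_uniq // => -[? ?] [? ?] _ _ [-> ->].
rewrite big_allpairs_dep /=.
under [RHS]eq_bigr => a _ do under eq_bigr => b _ do rewrite mulr_sumr.
under [RHS]eq_bigr => a _ do rewrite exchange_big /=.
rewrite exchange_big /=; apply: eq_bigr => k _.
rewrite !cf !dg !(lie_sumE _ (w := w)) // -/R.
have prod2 (F G : lie_tree V -> K) :
    (\sum_(a <- R) F a) * (\sum_(b <- R) G b)
    = \sum_(a <- R) \sum_(b <- R) F a * G b.
  by rewrite mulr_suml; apply: eq_bigr => a _; rewrite mulr_sumr.
rewrite !prod2 [in RHS]exchange_big /= [X in _ - _ * X]exchange_big /=.
rewrite mulr_sumr -sumrB exchange_big /=; apply: eq_bigr => a _.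
rewrite mulr_sumr -sumrB; apply: eq_bigr => b _; ring.
Qed.

End LieSeries.

HB.instance Definition _ (K : comAlgType rat) (V : free_graded) :=
  GRing.isSubmodClosed.Build K (series K V) (@lie_pred K V)
    (@lie_pred_submod K V).

(* The free complete Lie algebra on Sigma V^*.  The carrier also contains the
   inhomogeneous series; the graded module is given by the pieces lie_deg d
   below.  The sum of the pieces is dense, so that continuous maps of degree k
   between the graded modules and continuous maps of degree k on this carrier
   correspond to each other by restriction. *)
Record lie (K : comAlgType rat) (V : free_graded) := Lie {
  lie_val :> word V -> K^o;
  lie_valP : lie_val \in @lie_pred K V
}.

HB.instance Definition _ (K : comAlgType rat) (V : free_graded) :=
  [isSub for @lie_val K V].
HB.instance Definition _ (K : comAlgType rat) (V : free_graded) :=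
  [Choice of lie K V by <:].
HB.instance Definition _ (K : comAlgType rat) (V : free_graded) :=
  [SubChoice_isSubLmodule of lie K V by <:].

Section FreeLie.
Variables (K : comAlgType rat) (gr : even_grading K) (V : free_graded).
Local Notation L := (lie K V).
Implicit Types (f g : L) (E F : L -> L).

Lemma lie_bracket_subproof f g : sbracket f g \in @lie_pred K V.
Proof.
by apply/asboolP; apply: lie_series_bracket; apply/asboolP; apply: lie_valP.
Qed.

Definition lie_bracket f g : L := Lie (lie_bracket_subproof f g).

Definition lie_deg (d : int) : set L :=
  [set f : L | forall w, gr (d - wdeg w) (f w)].

Definition has_order (n : nat) : set L :=
  [set f : L | forall w, size w != n -> f w = 0].

Definition order_ge (n : nat) : set L :=
  [set f : L | forall w, (size w < n)%N -> f w = 0].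

(* Convergence for the profinite topology, in which the neighbourhoods of 0
   are given by the vanishing of finitely many coefficients. *)
Definition converges (u : nat -> L) f : Prop :=
  forall w, exists N, forall M, (N <= M)%N -> u M w = f w.

Definition continuous_endo E : Prop :=
  linear E /\
  forall w, exists s : seq (word V),
    forall f, (forall u, u \in s -> f u = 0) -> E f w = 0.

(* E raises the order by i - 1; the predecessor is harmless, as there is no
   nonzero element of order 0. *)
Definition endo_order (i : nat) E : Prop :=
  forall j f, has_order j f -> has_order (j + i).-1 (E f).

Definition endo_degree (k : int) E : Prop :=
  forall d f, lie_deg d f -> lie_deg (d + k) (E f).

(* The module (n), and congruence modulo it. *)
Definition endo_ge (n : nat) : set (L -> L) :=
  [set E | continuous_endo E /\
           forall j f, has_order j f -> order_ge (j + n).-1 (E f)].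

Definition eqmod (n : nat) E F : Prop := endo_ge n (E - F).

(* Homogeneous elements of Der. *)
Definition vector_field (k : int) E : Prop :=
  [/\ continuous_endo E, endo_degree k E &
      forall d f g, lie_deg d f ->
        E (lie_bracket f g) =
        lie_bracket (E f) g + (-1) ^+ `|(k * d)%R|%N *: lie_bracket f (E g)].

Definition commutator (k l : int) E F : L -> L :=
  fun f => E (F f) - (-1) ^+ `|(k * l)%R|%N *: F (E f).

Definition lie_exp E : L -> L := fun f =>
  xget 0 [set g | converges
    (fun M => \sum_(k < M) ((k`!%:R : rat)^-1)%:A *: iter k E f) g].

Definition lie_hom E : Prop :=
  [/\ continuous_endo E, endo_degree 0 E &
      forall f g, E (lie_bracket f g) = lie_bracket (E f) (E g)].

(* Diffeomorphisms of degree zero. *)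
Record diffeo := Diffeo {
  dfun :> L -> L;
  dinv : L -> L;
  dfun_hom : lie_hom dfun;
  dinv_hom : lie_hom dinv;
  dfunK : cancel dfun dinv;
  dinvK : cancel dinv dfun
}.

Definition pointed (phi : diffeo) : Prop :=
  exists phis : nat -> L -> L,
    (forall i, (2 <= i)%N -> continuous_endo (phis i) /\ endo_order i (phis i))
    /\ forall f, converges (fun M => f + \sum_(2 <= i < M) phis i f) (phi f).

(* Minimal C_n-structures m = m_2 + ... + m_{n-1}, presented by the family of
   their homogeneous parts, which m determines. *)
Record Cn_structure (n : nat) := CnStructure {
  Cn_part : nat -> L -> L;
  Cn_part_field : forall i, (2 <= i < n)%N -> vector_field 1 (Cn_part i);
  Cn_part_order : forall i, (2 <= i < n)%N -> endo_order i (Cn_part i);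
  Cn_part_out : forall i, ~~ (2 <= i < n)%N -> Cn_part i = 0;
  Cn_square : let m := \sum_(2 <= i < n) Cn_part i in
    eqmod n.+1 (m \o m) 0
}.

Definition Cn_field n (m : Cn_structure n) : L -> L :=
  \sum_(2 <= i < n) Cn_part m i.

Lemma lie_eqP f g : (forall w, f w = g w) -> f = g.
Proof. by move=> fg; apply: val_inj; apply: funext. Qed.

Lemma lie0E w : (0 : L) w = 0. Proof. by []. Qed.
Lemma lieDE f g w : (f + g) w = f w + g w. Proof. by []. Qed.
Lemma lieBE f g w : (f - g) w = f w - g w. Proof. by []. Qed.
Lemma lieZE (a : K) f w : (a *: f) w = a * f w. Proof. by []. Qed.

Lemma lie_bracketE f g w : lie_bracket f g w = sbracket f g w. Proof. by [].
Qed.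

Lemma lie_bracketBl f f' g :
  lie_bracket (f - f') g = lie_bracket f g - lie_bracket f' g.
Proof.
apply: lie_eqP => w; rewrite lieBE !lie_bracketE /sbracket -sumrB.
by apply: eq_bigr => k _; rewrite !lieBE; ring.
Qed.

Lemma lie_bracketBr f g g' :
  lie_bracket f (g - g') = lie_bracket f g - lie_bracket f g'.
Proof.
apply: lie_eqP => w; rewrite lieBE !lie_bracketE /sbracket -sumrB.
by apply: eq_bigr => k _; rewrite !lieBE; ring.
Qed.

Lemma has_order0 n : has_order n (0 : L). Proof. by []. Qed.

Lemma has_orderB n f g : has_order n f -> has_order n g -> has_order n (f - g).
Proof. by move=> hf hg w wn; rewrite lieBE hf // hg // subrr. Qed.

Lemma has_orderD n f g : has_order n f -> has_order n g -> has_order n (f + g).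
Proof. by move=> hf hg w wn; rewrite lieDE hf // hg // addr0. Qed.

Lemma order_ge0 n : order_ge n (0 : L). Proof. by []. Qed.

Lemma order_geD n f g : order_ge n f -> order_ge n g -> order_ge n (f + g).
Proof. by move=> hf hg w wn; rewrite lieDE hf // hg // addr0. Qed.

Lemma order_geB n f g : order_ge n f -> order_ge n g -> order_ge n (f - g).
Proof. by move=> hf hg w wn; rewrite lieBE hf // hg // subrr. Qed.

Lemma has_order_ge n k f : (k <= n)%N -> has_order n f -> order_ge k f.
Proof. by move=> kn hf w wk; apply: hf; apply: contraTneq wk => ->; lia. Qed.

Lemma linearE_B E f g : linear E -> E (f - g) = E f - E g.
Proof.
by move=> lE; rewrite [f - g]addrC -scaleN1r lE scaleN1r [RHS]addrC.
Qed.

Lemma linearE_0 E : linear E -> E 0 = 0.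
Proof. by move=> lE; rewrite -[X in E X](subrr 0) linearE_B // subrr. Qed.

Lemma linearE_D E f g : linear E -> E (f + g) = E f + E g.
Proof. by move=> lE; have := lE 1 f g; rewrite !scale1r. Qed.

Lemma endo0E f : (0 : L -> L) f = 0. Proof. by []. Qed.
Lemma endoDE E F f : (E + F) f = E f + F f. Proof. by []. Qed.
Lemma endoBE E F f : (E - F) f = E f - F f. Proof. by []. Qed.

Lemma continuous_endo0 : continuous_endo 0.
Proof.
split=> [a f g|w]; last by exists [::].
by rewrite !(endo0E, endoBE) scaler0 addr0.
Qed.

Lemma continuous_endoB E F :
  continuous_endo E -> continuous_endo F -> continuous_endo (E - F).
Proof.
move=> [lE cE] [lF cF]; split=> [a f g|w].
  by rewrite !(endo0E, endoBE) lE lF scalerBr; apply: lie_eqP => w; rewrite !(lieBE, lieDE); ring.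
have [s sE] := cE w; have [t tF] := cF w; exists (s ++ t) => f f0.
rewrite !(endo0E, endoBE) lieBE sE ?tF ?subrr // => u us; apply: f0;
  by rewrite mem_cat us ?orbT.
Qed.

Lemma continuous_endoD E F :
  continuous_endo E -> continuous_endo F -> continuous_endo (E + F).
Proof.
move=> cE cF; rewrite -[F]opprK -[- F]sub0r.
by do 2 ?[apply: continuous_endoB => //]; apply: continuous_endo0.
Qed.

Lemma continuous_endo_comp E F :
  continuous_endo E -> continuous_endo F -> continuous_endo (E \o F).
Proof.
move=> [lE cE] [lF cF]; split=> [a f g|w]; first by rewrite /= lF lE.
have [s sE] := cE w.
have [t tP] : exists t : seq (word V), forall f,
    (forall u, u \in t -> f u = 0) -> forall v, v \in s -> F f v = 0.
  elim: s {sE} => [|v s [t IH]]; first by exists [::].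
  have [r rP] := cF v; exists (r ++ t) => f f0 x.
  rewrite inE => /orP [/eqP ->|xs].
    by apply: rP => u ur; apply: f0; rewrite mem_cat ur.
  by apply: IH xs => u ut; apply: f0; rewrite mem_cat ut orbT.
by exists t => f f0; apply: sE; apply: tP.
Qed.

Lemma endo_orderB i E F :
  endo_order i E -> endo_order i F -> endo_order i (E - F).
Proof. by move=> oE oF j f jf; apply: has_orderB; [apply: oE|apply: oF]. Qed.

Lemma vector_field0 k : vector_field k 0.
Proof.
split; first exact: continuous_endo0.
  by move=> d f _ w; rewrite lie0E; apply: gr_piece0.
move=> d f g _; rewrite !(endo0E, endoBE); apply: lie_eqP => w.
rewrite lieDE lieZE !lie_bracketE /sbracket !big1 ?mulr0 ?addr0 //.
  by move=> i _; rewrite !(lie0E, mulr0, mul0r, subr0).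
by move=> i _; rewrite !(lie0E, mulr0, mul0r, subr0).
Qed.

Lemma vector_fieldB k E F :
  vector_field k E -> vector_field k F -> vector_field k (E - F).
Proof.
move=> [cE dE bE] [cF dF bF]; split; first exact: continuous_endoB.
  move=> d f df w; rewrite !(endo0E, endoBE) lieBE.
  by apply: gr_pieceB; [apply: dE|apply: dF].
move=> d f g df; rewrite !(endo0E, endoBE) (bE d) // (bF d) //.
rewrite lie_bracketBl lie_bracketBr.
by apply: lie_eqP => w; rewrite !(lieBE, lieDE, lieZE); ring.
Qed.

Section Truncation.
Variables (n : nat) (m : Cn_structure n.+1).

Definition trunc_part (i : nat) : L -> L :=
  if (2 <= i < n)%N then Cn_part m i else 0.

Let part_cont i : continuous_endo (Cn_part m i).
Proof.
have [hi|hi] := boolP (2 <= i < n.+1)%N; first by have [] := Cn_part_field m hi.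
by rewrite Cn_part_out //; apply: continuous_endo0.
Qed.

Let part_order i : endo_order i (Cn_part m i).
Proof.
have [hi|hi] := boolP (2 <= i < n.+1)%N; first exact: Cn_part_order.
by rewrite Cn_part_out // => j f _; apply: has_order0.
Qed.

Let total := \sum_(2 <= i < n) trunc_part i.

Let totalE : total = \sum_(2 <= i < n) Cn_part m i.
Proof.
rewrite /total !big_nat; apply: eq_bigr => i hi.
by rewrite /trunc_part hi.
Qed.

Let total_cont : continuous_endo total.
Proof.
rewrite totalE; elim/big_ind: _ => //; first exact: continuous_endo0.
exact: continuous_endoD.
Qed.

Lemma trunc_part_field i : (2 <= i < n)%N -> vector_field 1 (trunc_part i).
Proof.
by move=> hi; rewrite /trunc_part hi; apply: Cn_part_field; lia.
Qed.

Lemma trunc_part_order i : (2 <= i < n)%N -> endo_order i (trunc_part i).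
Proof. by move=> hi; rewrite /trunc_part hi. Qed.

Lemma trunc_part_out i : ~~ (2 <= i < n)%N -> trunc_part i = 0.
Proof. by move=> hi; rewrite /trunc_part (negbTE hi). Qed.

Lemma trunc_square : let t := \sum_(2 <= i < n) trunc_part i in
  eqmod n.+1 (t \o t) 0.
Proof.
rewrite /= -/total /eqmod subr0; split; first exact: continuous_endo_comp.
move=> j f jf.
have [n2|n2] := ltnP n 2.
  by rewrite /total big_geq ?(ltnW n2) //.
have [_ sq] := Cn_square m; have := sq j f jf.
rewrite big_nat_recr //= -totalE subr0 => sqf.
set g := Cn_part m n f in sqf.
have jg : has_order (j + n).-1 g by apply: part_order.
have [lt _] := total_cont; have [lp _] := part_cont n.
have total_sum h : total h = \sum_(2 <= i < n) Cn_part m i h.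
  by rewrite totalE fct_sumE.
have tg : order_ge (j + n) (total g).
  rewrite total_sum big_nat; elim/big_ind: _ => //.
    by move=> x y; apply: order_geD.
  move=> i /andP [i2 _]; apply: has_order_ge (part_order jg).
  by have := i2; lia.
have pt : order_ge (j + n) (Cn_part m n (total f)).
  rewrite total_sum big_nat.
  elim/big_ind: _ => //; first by rewrite linearE_0.
    by move=> x y hx hy; rewrite linearE_D //; apply: order_geD.
  move=> i /andP [i2 _]; apply: has_order_ge (part_order (part_order jf)).
  by have := i2; lia.
have pg : order_ge (j + n) (Cn_part m n g).
  by apply: has_order_ge (part_order jg); lia.
move=> w sw.
have tE : (total + Cn_part m n) ((total + Cn_part m n) f)
  = total (total f) + total g + (Cn_part m n (total f) + Cn_part m n g).
  by rewrite !endoDE (linearE_D _ _ lt) (linearE_D _ _ lp).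
have := sqf w; rewrite /comp tE lieDE [in X in X + _]lieDE [in X in _ + X]lieDE.
rewrite (tg w) ?(pt w) ?(pg w) ?addr0; try lia.
by apply; lia.
Qed.

End Truncation.

(* The C_n-structure underlying a C_{n+1}-structure: the part m_n is dropped. *)
Definition Cn_trunc n (m : Cn_structure n.+1) : Cn_structure n :=
  CnStructure (@trunc_part_field n m) (@trunc_part_order n m)
    (@trunc_part_out n m) (@trunc_square n m).

(* Strictly graded commutative algebra structures on V. *)
Record sgc_algebra := SgcAlgebra {
  sgc_mul :> L -> L;
  sgc_mul_field : vector_field 1 sgc_mul;
  sgc_mul_order : endo_order 2 sgc_mul;
  sgc_mul_square : sgc_mul \o sgc_mul = 0
}.

Definition has_underlying_algebra n (m : Cn_structure n) (A : sgc_algebra) :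
  Prop := Cn_part m 2 = A.

Definition Cn_morphism n (m m' : Cn_structure n) (phi : diffeo) : Prop :=
  eqmod n (phi \o Cn_field m) (Cn_field m' \o phi).

Record pointed_morphism n (m m' : Cn_structure n) := PointedMorphism {
  pm_diffeo :> diffeo;
  pm_pointed : pointed pm_diffeo;
  pm_morphism : Cn_morphism m m' pm_diffeo
}.

HB.instance Definition _ n m m' := gen_eqMixin (@pointed_morphism n m m').
HB.instance Definition _ n m m' := gen_choiceMixin (@pointed_morphism n m m').

Definition homotopic n (m m' : Cn_structure n)
    (phi phi' : pointed_morphism m m') : Prop :=
  exists eta, vector_field (-1) eta /\
    eqmod n.-1 phi (phi' \o lie_exp (commutator 1 (-1) (Cn_field m) eta)).

Section Moduli.
Variables (n : nat) (m m' : Cn_structure n).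

(* Dividing by homotopy means dividing by the equivalence relation which it
   generates. *)
Definition homotopy_rel : rel (pointed_morphism m m') :=
  fun phi phi' => `[< Relation_Operators.clos_refl_sym_trans _ (@homotopic n m m') phi phi' >].

Lemma homotopy_rel_refl : reflexive homotopy_rel.
Proof. by move=> phi; apply/asboolP; apply: Relation_Operators.rst_refl. Qed.

Lemma homotopy_rel_sym : symmetric homotopy_rel.
Proof.
by move=> phi psi; apply/idP/idP => /asboolP h; apply/asboolP; apply: Relation_Operators.rst_sym.
Qed.

Lemma homotopy_rel_trans : transitive homotopy_rel.
Proof.
move=> psi phi chi /asboolP h /asboolP h'; apply/asboolP.
exact: Relation_Operators.rst_trans h h'.
Qed.

Canonical homotopy_equiv :=
  EquivRel homotopy_rel homotopy_rel_refl homotopy_rel_sym homotopy_rel_trans.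

Definition moduli := {eq_quot homotopy_equiv}%qT.

Definition moduli_class (phi : pointed_morphism m m') : moduli :=
  (\pi_moduli phi)%qT.

End Moduli.

Definition extendable n (m m' : Cn_structure n.+1)
    (phi : pointed_morphism (Cn_trunc m) (Cn_trunc m')) : Prop :=
  exists gamma, [/\ vector_field 0 gamma, endo_order n.-1 gamma &
    exists psi : diffeo,
      (psi : L -> L) = lie_exp gamma \o phi /\ Cn_morphism m m' psi].

Section Harrison.
Variable A : sgc_algebra.

(* Vector fields of order i and of degree j in Sigma^-1 Der. *)
Definition harr_cochain (i : nat) (j : int) : set (L -> L) :=
  [set xi | vector_field (j - 1) xi /\ endo_order i xi].

(* The differential on cochains of bidegree (_, j). *)
Definition harr_diff (j : int) (xi : L -> L) : L -> L :=
  commutator 1 (j - 1) A xi.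

Lemma harr_cochain0 i j : harr_cochain i j 0.
Proof. by split; [apply: vector_field0|move=> a f _; apply: has_order0]. Qed.

Lemma harr_cochainB i j xi zeta :
  harr_cochain i j xi -> harr_cochain i j zeta -> harr_cochain i j (xi - zeta).
Proof.
by move=> [vx ox] [vz oz]; split; [apply: vector_fieldB|apply: endo_orderB].
Qed.

Lemma harr_diff0 j : harr_diff j 0 = 0.
Proof.
apply: funext => f; rewrite /harr_diff /commutator !endo0E scaler0 subr0.
by have [[lA _] _ _] := sgc_mul_field A; apply: linearE_0.
Qed.

Lemma harr_diffB j xi zeta :
  harr_diff j (xi - zeta) = harr_diff j xi - harr_diff j zeta.
Proof.
apply: funext => f; rewrite endoBE /harr_diff /commutator !endoBE.
have [[lA _] _ _] := sgc_mul_field A; rewrite linearE_B //.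
by apply: lie_eqP => w; rewrite !(lieBE, lieZE); ring.
Qed.

Section Bidegree.
Variables (i : nat) (j : int).

Definition cocycle_pred : {pred (L -> L)} :=
  fun xi => `[< harr_cochain i j xi /\ harr_diff j xi = 0 >].

Lemma cocycle_pred_zmod : zmod_closed cocycle_pred.
Proof.
split; first by apply/asboolP; split; [apply: harr_cochain0|apply: harr_diff0].
move=> x y /asboolP [cx dx] /asboolP [cy dy]; apply/asboolP; split.
  exact: harr_cochainB.
by rewrite harr_diffB dx dy subrr.
Qed.

HB.instance Definition _ :=
  GRing.isZmodClosed.Build (L -> L) cocycle_pred cocycle_pred_zmod.

Record harr_cocycle := HarrCocycle {
  cocycle_val :> L -> L;
  cocycle_valP : cocycle_val \in cocycle_pred
}.

HB.instance Definition _ := [isSub for cocycle_val].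
HB.instance Definition _ := [Choice of harr_cocycle by <:].
HB.instance Definition _ := [SubChoice_isSubZmodule of harr_cocycle by <:].

(* For i = 0 the predecessor is harmless: there is no nonzero vector field of
   order 0. *)
Definition coboundary_pred : {pred harr_cocycle} := fun xi =>
  `[< exists2 beta, harr_cochain i.-1 (j - 1) beta
                  & (xi : L -> L) = harr_diff (j - 1) beta >].

Lemma coboundary_pred_zmod : zmod_closed coboundary_pred.
Proof.
split.
  by apply/asboolP; exists 0; [apply: harr_cochain0|rewrite harr_diff0].
move=> x y /asboolP [b cb xb] /asboolP [c cc yc]; apply/asboolP.
by exists (b - c); [apply: harr_cochainB|rewrite harr_diffB -xb -yc].
Qed.

HB.instance Definition _ :=
  GRing.isZmodClosed.Build harr_cocycle coboundary_pred coboundary_pred_zmod.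

(* H^{i,j}_Harr(A, A), as an abelian group. *)
Definition harr_cohomology := Quotient.quot coboundary_pred.

Definition harr_class (xi : harr_cocycle) : harr_cohomology :=
  (\pi_harr_cohomology xi)%qT.

End Bidegree.
End Harrison.

End FreeLie.

(* Main.v *)
(* Filter the endomorphisms by the amount k by which they raise the order.  The
   components of lowest order carry all the information: a pointed phi is the
   identity modulo k = 1, so that X := phi m phi^-1 - m' raises the order by at
   least n - 1, and obs(phi) is its component of order n.  It is a derivation
   since X is one, and a Harrison cocycle because (m' + X)^2 = phi m^2 phi^-1
   and m'^2 vanish modulo (n + 2), as does X^2 for n >= 3.

   If phi is homotopic to phi' via eta and e := exp [mbar, eta], then e commutes
   with m modulo (n + 1), as [mbar, [mbar, eta]] = [mbar^2, eta].  The two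
   homomorphisms phi'^-1 phi and e agree modulo (n - 1), so the component beta
   of order n - 1 of their difference is a derivation, and conjugation of m by
   phi'^-1 phi adds [beta, m_2] to the component of order n.  Likewise
   exp(gamma) = 1 + gamma modulo (n), so exp(gamma) phi is a C_{n+1}-morphism
   exactly when [m_2, gamma] = obs(phi). *)
Require Import Defs.
From mathcomp Require Import all_boot all_order all_algebra.
From mathcomp Require Import all_classical.
From mathcomp Require Import zify ring.
Set Implicit Arguments.
Unset Strict Implicit.
Unset Printing Implicit Defensive.
Import GRing.Theory.
Local Open Scope classical_set_scope.
Local Open Scope ring_scope.

(** * Lie series *)

Section LieSeriesTheory.
Variables (K : comAlgType rat) (V : free_graded).
Local Notation L := (lie K V).
Implicit Types (f g : L) (E F : L -> L) (t : lie_tree V).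

Lemma lieNE f w : (- f) w = - f w. Proof. by []. Qed.

Lemma lie_sum_coef (I : Type) (r : seq I) (P : pred I) (F : I -> L) w :
  (\sum_(i <- r | P i) F i) w = \sum_(i <- r | P i) F i w.
Proof.
exact: (big_morph (fun f : L => f w)).
Qed.

(** * Bilinearity, continuity and order of the bracket *)

Lemma lie_bracketDl f f' g :
  lie_bracket (f + f') g = lie_bracket f g + lie_bracket f' g.
Proof.
apply: lie_eqP => w; rewrite lieDE !lie_bracketE /sbracket -big_split.
by apply: eq_bigr => k _; rewrite !lieDE /=; ring.
Qed.

Lemma lie_bracketDr f g g' :
  lie_bracket f (g + g') = lie_bracket f g + lie_bracket f g'.
Proof.
apply: lie_eqP => w; rewrite lieDE !lie_bracketE /sbracket -big_split.
by apply: eq_bigr => k _; rewrite !lieDE /=; ring.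
Qed.

Lemma lie_bracketZl a f g : lie_bracket (a *: f) g = a *: lie_bracket f g.
Proof.
apply: lie_eqP => w; rewrite lieZE !lie_bracketE /sbracket mulr_sumr.
by apply: eq_bigr => k _; rewrite !lieZE /=; ring.
Qed.

Lemma lie_bracketZr a f g : lie_bracket f (a *: g) = a *: lie_bracket f g.
Proof.
apply: lie_eqP => w; rewrite lieZE !lie_bracketE /sbracket mulr_sumr.
by apply: eq_bigr => k _; rewrite !lieZE /=; ring.
Qed.

Lemma lie_bracket0l g : lie_bracket 0 g = 0.
Proof. by rewrite -[0 in LHS](subrr 0) lie_bracketBl subrr. Qed.

Lemma lie_bracket0r f : lie_bracket f 0 = 0.
Proof. by rewrite -[0 in LHS](subrr 0) lie_bracketBr subrr. Qed.

Lemma lie_bracket_suml (I : Type) (r : seq I) (P : pred I) (F : I -> L) g :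
  lie_bracket (\sum_(i <- r | P i) F i) g
  = \sum_(i <- r | P i) lie_bracket (F i) g.
Proof.
exact: (big_morph (fun x => lie_bracket x g) (fun x y => lie_bracketDl x y g)
  (lie_bracket0l g)).
Qed.

Lemma lie_bracket_sumr (I : Type) (r : seq I) (P : pred I) f (F : I -> L) :
  lie_bracket f (\sum_(i <- r | P i) F i)
  = \sum_(i <- r | P i) lie_bracket f (F i).
Proof.
exact: (big_morph (fun x => lie_bracket f x) (lie_bracketDr f)
  (lie_bracket0r f)).
Qed.

(** A coefficient of a bracket at [w] only involves prefixes and suffixes of [w]; this finite list
    witnesses continuity of the bracket in each argument. *)
Lemma mem_splits (w : word V) : exists s : seq (word V),
  (forall k : 'I_(size w).+1, take k w \in s) /\
  (forall k : 'I_(size w).+1, drop k w \in s).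
Proof.
exists ([seq take k w | k <- iota 0 (size w).+1]
        ++ [seq drop k w | k <- iota 0 (size w).+1]).
have kw (k : 'I_(size w).+1) : (k : nat) \in iota 0 (size w).+1.
  by rewrite mem_iota add0n ltn_ord.
by split=> k; rewrite mem_cat; apply/orP; [left|right]; apply/mapP;
  exists (k : nat).
Qed.

Lemma continuous_endoZ (a : K) E :
  continuous_endo E -> continuous_endo (fun f => a *: E f).
Proof.
move=> [lE cE]; split=> [b f g|w].
  by rewrite lE; apply: lie_eqP => w; rewrite !(lieZE, lieDE) /=; ring.
by have [s sE] := cE w; exists s => f /sE; rewrite lieZE => ->; rewrite mulr0.
Qed.

Lemma continuous_bracketl g : continuous_endo (fun f => lie_bracket f g).
Proof.
split=> [a f f'|w]; first by rewrite lie_bracketDl lie_bracketZl.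
have [s [st sd]] := mem_splits w; exists s => f f0.
rewrite lie_bracketE /sbracket big1 // => k _.
by rewrite (f0 _ (st k)) (f0 _ (sd k)) !(mul0r, mulr0) subrr.
Qed.

Lemma continuous_bracketr f : continuous_endo (fun g => lie_bracket f g).
Proof.
split=> [a g g'|w]; first by rewrite lie_bracketDr lie_bracketZr.
have [s [st sd]] := mem_splits w; exists s => g g0.
rewrite lie_bracketE /sbracket big1 // => k _.
by rewrite (g0 _ (st k)) (g0 _ (sd k)) !(mul0r, mulr0) subrr.
Qed.

Lemma size_take_drop (T : Type) k (w : seq T) :
  (size (take k w) + size (drop k w) = size w)%N.
Proof. by rewrite -size_cat cat_take_drop. Qed.

Lemma order_ge_bracket a b f g :
  order_ge a f -> order_ge b g -> order_ge (a + b) (lie_bracket f g).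
Proof.
move=> fa gb w wab; rewrite lie_bracketE /sbracket big1 // => k _.
have sz := size_take_drop k w.
have -> : f (take k w) * g (drop k w) = 0.
  have [lt|le] := ltnP (size (take k w)) a; first by rewrite fa ?mul0r.
  by rewrite gb ?mulr0 //; lia.
have -> : g (take k w) * f (drop k w) = 0.
  have [lt|le] := ltnP (size (take k w)) b; first by rewrite gb ?mul0r.
  by rewrite fa ?mulr0 //; lia.
by rewrite mulr0 subrr.
Qed.

Lemma has_order_bracket a b f g :
  has_order a f -> has_order b g -> has_order (a + b) (lie_bracket f g).
Proof.
move=> fa gb w wab; rewrite lie_bracketE /sbracket big1 // => k _.
have sz := size_take_drop k w.
have -> : f (take k w) * g (drop k w) = 0.
  have [lt|le] := eqVneq (size (take k w)) a; last by rewrite fa ?mul0r.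
  by rewrite gb ?mulr0 //; lia.
have -> : g (take k w) * f (drop k w) = 0.
  have [lt|le] := eqVneq (size (take k w)) b; last by rewrite gb ?mul0r.
  by rewrite fa ?mulr0 //; lia.
by rewrite mulr0 subrr.
Qed.

Lemma order_ge_leq j k f : (j <= k)%N -> order_ge k f -> order_ge j f.
Proof. by move=> jk fk w wj; apply: fk; lia. Qed.

Lemma order_geZ n (a : K) f : order_ge n f -> order_ge n (a *: f).
Proof. by move=> fn w wn; rewrite lieZE fn ?mulr0. Qed.

Lemma order_ge_sum n (I : Type) (r : seq I) (P : pred I) (F : I -> L) :
  (forall i, P i -> order_ge n (F i)) -> order_ge n (\sum_(i <- r | P i) F i).
Proof.
by move=> H; elim/big_ind: _ => // x y; apply: order_geD.
Qed.

Lemma has_order_order_ge_eq0 n f : has_order n f -> order_ge n.+1 f -> f = 0.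
Proof.
move=> hf gf; apply: lie_eqP => w; rewrite lie0E.
by have [sw|/hf //] := eqVneq (size w) n; apply: gf; rewrite sw.
Qed.

(** A Lie monomial lives on words of one length, its number of leaves. So the component of each
    length may be prescribed by a separate Lie series: the coefficient of [t] is taken from series
    number [nleaves t]. Components and infinite sums below are built this way, which spares a search
    for their Lie expansions. *)
Lemma lie_glue_subproof (h : nat -> L) :
  (fun w => h (size w) w : K^o) \in @lie_pred K V.
Proof.
have /choice [c cP] : forall n, exists c : lie_tree V -> K, forall w,
    h n w = \sum_(t \in [set: lie_tree V]) (c t * lie_monomial K t w).
  by move=> n; have /asboolP := lie_valP (h n).
apply/asboolP; exists (fun t => c (nleaves t) t) => w.
rewrite cP; apply: eq_fsbigr => t _.
have [-> |/lie_monomial_supp [-> _] //] := eqVneq (lie_monomial K t w) 0.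
by rewrite !mulr0.
Qed.

Definition lie_glue (h : nat -> L) : L := Lie (lie_glue_subproof h).

Lemma lie_glueE h w : lie_glue h w = h (size w) w. Proof. by []. Qed.

Definition order_part j f : L := lie_glue (fun i => if i == j then f else 0).

Lemma order_partE j f w : order_part j f w = if size w == j then f w else 0.
Proof. by rewrite lie_glueE; case: ifP. Qed.

Lemma has_order_part j f : has_order j (order_part j f).
Proof. by move=> w; rewrite order_partE => /negbTE ->. Qed.

Lemma order_part_id j f : has_order j f -> order_part j f = f.
Proof.
move=> fj; apply: lie_eqP => w; rewrite order_partE.
by case: eqP => // /eqP /fj ->.
Qed.

Lemma order_part_neq i j f : i != j -> has_order j f -> order_part i f = 0.
Proof.
move=> ij fj; apply: lie_eqP => w; rewrite order_partE lie0E.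
by case: eqP => // wi; apply: fj; rewrite wi.
Qed.

Lemma order_part_linear j : linear (order_part j).
Proof.
move=> a f g; apply: lie_eqP => w; rewrite !(lieDE, lieZE, order_partE).
by case: ifP => //; rewrite mulr0 addr0.
Qed.

(** * Lie monomials, density and continuity *)

Lemma lie_monomial_series t : lie_monomial K t \in @lie_pred K V.
Proof.
apply/asboolP; exists (fun t' => (t' == t)%:R) => w.
rewrite (@lie_sum_seq _ _ _ _ [:: t]) //.
  by rewrite big_seq1 eqxx mul1r.
by move=> t'; rewrite inE; case: (t' =P t) => // _; rewrite mul0r eqxx.
Qed.

Definition mono t : L := Lie (lie_monomial_series t).

Lemma monoE t w : mono t w = lie_monomial K t w. Proof. by []. Qed.

Lemma mono_node t1 t2 : mono (Node t1 t2) = lie_bracket (mono t1) (mono t2).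
Proof. exact: lie_eqP. Qed.

Lemma has_order_mono t : has_order (nleaves t) (mono t).
Proof.
move=> w sw; rewrite monoE; apply/eqP; apply: contraNT sw.
by move=> /lie_monomial_supp [->].
Qed.

Lemma order_ge1 f : order_ge 1 f.
Proof.
move=> [|? ?] // _; have /asboolP [c ->] := lie_valP f.
rewrite (@lie_sum_seq _ _ _ _ [::]) ?big_nil // => t.
have [->|/lie_monomial_supp [/= s _]] := eqVneq (lie_monomial K t [::]) 0.
  by rewrite mulr0 eqxx.
by have := nleaves_gt0 t; rewrite -s.
Qed.

Lemma mono_dense j f (s : seq (word V)) : order_ge j f ->
  exists (R : seq (lie_tree V)) (c : lie_tree V -> K),
    (forall t, t \in R -> (j <= nleaves t)%N) /\
    (forall u, u \in s -> f u = (\sum_(t <- R) c t *: mono t) u).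
Proof.
move=> fj; have /asboolP [c cf] := lie_valP f.
set W := flatten s; set R := undup (trees_over (size W) W).
exists [seq t <- R | (j <= nleaves t)%N], c; split.
  by move=> t; rewrite mem_filter => /andP [].
move=> u us; rewrite lie_sum_coef big_filter.
have sz : (size u <= size W)%N.
  by rewrite /W; elim: s us {W R} => //= v s IH;
    rewrite inE size_cat => /orP [/eqP ->|/IH]; lia.
have sub : {subset u <= W} by move=> x xu; apply/flattenP; exists u.
have [lt|ge] := ltnP (size u) j.
  rewrite fj // big1 // => t tj; rewrite lieZE monoE.
  have [->|/lie_monomial_supp [/= s1 _]] := eqVneq (lie_monomial K t u) 0.
    by rewrite mulr0.
  by move: lt tj; rewrite s1; lia.
rewrite cf (lie_sumE _ (w := W)) // -/R [RHS]big_mkcond /=.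
apply: eq_bigr => t _; case: ifP => //= tj.
have [->|/lie_monomial_supp [/= s1 _]] := eqVneq (lie_monomial K t u) 0.
  by rewrite mulr0.
by move: tj; rewrite -s1 ge.
Qed.

Lemma linearE_Z E (a : K) f : linear E -> E (a *: f) = a *: E f.
Proof.
by move=> lE; have := lE a f 0; rewrite (linearE_0 lE) !addr0.
Qed.

Lemma linearE_sum E (I : Type) (r : seq I) (P : pred I) (F : I -> L) :
  linear E -> E (\sum_(i <- r | P i) F i) = \sum_(i <- r | P i) E (F i).
Proof.
by move=> lE;
  exact: (big_morph E (fun x y => linearE_D x y lE) (linearE_0 lE)).
Qed.

Lemma continuous_endo_coef E f w : continuous_endo E ->
  exists s : seq (word V),
  forall g, (forall u, u \in s -> f u = g u) -> E f w = E g w.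
Proof.
move=> [lE cE]; have [s sP] := cE w; exists s => g fg.
apply/eqP; rewrite -subr_eq0 -lieBE -linearE_B // sP // => u us.
by rewrite lieBE fg ?subrr.
Qed.

(** By continuity a coefficient of [E f] depends on finitely many coefficients of [f], and there [f]
    agrees with a finite combination of monomials. Order estimates thus reduce to induction on
    trees. *)
Lemma order_ge_mono_ext E j k f : continuous_endo E ->
  (forall t, (j <= nleaves t)%N -> order_ge k (E (mono t))) ->
  order_ge j f -> order_ge k (E f).
Proof.
move=> cE H fj w wk; have [s sP] := continuous_endo_coef f w cE.
have [R [c [Rj Rf]]] := mono_dense s fj.
rewrite (sP _ Rf) linearE_sum; last by case: cE.
rewrite big_seq_cond; apply: (@order_ge_sum k) => // t /andP [tR _].
by rewrite linearE_Z; [apply/order_geZ/H/Rj|case: cE].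
Qed.

Lemma continuous_endo_mono_eq0 E :
  continuous_endo E -> (forall t, E (mono t) = 0) -> forall f, E f = 0.
Proof.
move=> cE H f; apply: lie_eqP => w; rewrite lie0E.
apply: (@order_ge_mono_ext E 0 (size w).+1) => //.
by move=> t _; rewrite H; apply: order_ge0.
Qed.

(** The same reduction with homogeneous components in place of monomials. The components inherit the
    degree of [f], which the sign in the Leibniz rule requires. *)
Lemma continuous_endo_part E f k : continuous_endo E ->
  (forall j, order_ge k (E (order_part j f))) -> order_ge k (E f).
Proof.
move=> cE H w wk; have [s sP] := continuous_endo_coef f w cE.
set N := \max_(u <- s) size u.
rewrite (sP (\sum_(j < N.+1) order_part j f)).
  rewrite linearE_sum; last by case: cE.
  exact: (@order_ge_sum k).
move=> u us; have uN : (size u < N.+1)%N by rewrite ltnS /N leq_bigmax_seq.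
rewrite lie_sum_coef (bigD1 (Ordinal uN)) // big1.
  by rewrite order_partE /= eqxx addr0.
move=> i iu; rewrite order_partE ifN //; apply: contraNneq iu => ui.
by apply/eqP/val_inj.
Qed.

Lemma continuous_endo_part_eq0 E f : continuous_endo E ->
  (forall j, E (order_part j f) = 0) -> E f = 0.
Proof.
move=> cE H; apply: lie_eqP => w; rewrite lie0E.
apply: (@continuous_endo_part E f (size w).+1) => // j.
by rewrite H; apply: order_ge0.
Qed.

End LieSeriesTheory.

Ltac lie_ring :=
  apply: lie_eqP => ?; rewrite !(lieDE, lieBE, lieNE, lieZE, lie0E); ring.

(** * Endomorphisms raising the order *)

Definition invfact (K : comAlgType rat) k : K := ((k`!%:R : rat)^-1)%:A.

Lemma natr_alg (K : comAlgType rat) k : (k%:R : rat)%:A = k%:R :> K.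
Proof. by rewrite scaler_nat. Qed.

Lemma invfactS (K : comAlgType rat) k :
  k.+1%:R * invfact K k.+1 = invfact K k.
Proof.
rewrite /invfact -natr_alg -scalerAl mul1r scalerA factS natrM.
by rewrite invfM mulrA mulfV ?mul1r // Num.Theory.pnatr_eq0.
Qed.

Lemma natr_lregK (K : comAlgType rat) k (x y : K) :
  k.+1%:R * x = k.+1%:R * y -> x = y.
Proof.
move=> xy; have : (k.+1%:R^-1 : rat)%:A * (k.+1%:R * x)
  = (k.+1%:R^-1 : rat)%:A * (k.+1%:R * y) :> K by rewrite xy.
rewrite !mulrA -natr_alg -scalerAl mul1r scalerA mulVf ?scale1r ?mul1r //.
by rewrite Num.Theory.pnatr_eq0.
Qed.

Section Raising.
Variables (K : comAlgType rat) (V : free_graded).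
Local Notation L := (lie K V).
Implicit Types (f g : L) (E F : L -> L) (t : lie_tree V).

Lemma endo_compE E F f : (E \o F) f = E (F f). Proof. by []. Qed.

(* The module [(k.+1)]; with this shift the indices add up under composition. *)
Definition raises k E : Prop :=
  continuous_endo E /\ forall j f, order_ge j f -> order_ge (j + k) (E f).

Lemma raises_cont k E : raises k E -> continuous_endo E. Proof. by case. Qed.
Lemma raises_linear k E : raises k E -> linear E. Proof. by case=> -[]. Qed.

(** [endo_ge] tests homogeneous arguments only; monomials are homogeneous and dense enough to carry
    the bound to every series of order at least [j]. *)
Lemma endo_geP k E : endo_ge k.+1 E <-> raises k E.
Proof.
split=> -[cE H]; split=> // j f.
  apply: order_ge_mono_ext => // t jt.
  have := H _ _ (@has_order_mono K V t); rewrite addnS /=.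
  by apply: order_ge_leq; rewrite leq_add2r.
by move=> fj; rewrite addnS; apply: H; apply: has_order_ge fj.
Qed.

Lemma endo_eqmodP k E F : eqmod k.+1 E F <-> raises k (E - F).
Proof. exact: endo_geP. Qed.

Lemma raises_leq j k E : (j <= k)%N -> raises k E -> raises j E.
Proof.
move=> jk [cE H]; split=> // i f fi; apply: order_ge_leq (H _ _ fi).
by rewrite leq_add2l.
Qed.

Lemma raises_id : raises 0 (id : L -> L).
Proof.
split; last by move=> j f; rewrite addn0.
by split=> // w; exists [:: w] => f; apply; rewrite inE.
Qed.

Lemma raises0 k : raises k (0 : L -> L).
Proof. by split; [apply: continuous_endo0|move=> j f _; apply: order_ge0]. Qed.

Lemma raisesD k E F : raises k E -> raises k F -> raises k (E + F).
Proof.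
move=> [cE E1] [cF F1]; split; first exact: continuous_endoD.
by move=> j f fj; apply: order_geD; [apply: E1|apply: F1].
Qed.

Lemma raisesB k E F : raises k E -> raises k F -> raises k (E - F).
Proof.
move=> [cE E1] [cF F1]; split; first exact: continuous_endoB.
by move=> j f fj; apply: order_geB; [apply: E1|apply: F1].
Qed.

Lemma raisesN k E : raises k E -> raises k (- E).
Proof. by move=> rE; rewrite -sub0r; apply: raisesB => //; apply: raises0. Qed.

Lemma raises_sum k (I : Type) (r : seq I) (P : pred I) (F : I -> L -> L) :
  (forall i, P i -> raises k (F i)) -> raises k (\sum_(i <- r | P i) F i).
Proof.
move=> H; elim/big_ind: _ => //; first exact: raises0.
exact: raisesD.
Qed.

Lemma raises_comp j k E F : raises j E -> raises k F -> raises (j + k) (E \o F).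
Proof.
move=> [cE E1] [cF F1]; split; first exact: continuous_endo_comp.
by move=> i f fi; rewrite [(j + k)%N]addnC addnA; apply/E1/F1.
Qed.

Lemma raises_compl k E F : raises k E -> raises 0 F -> raises k (E \o F).
Proof. by move=> rE rF; have := raises_comp rE rF; rewrite addn0. Qed.

Lemma raises_compr k E F : raises 0 E -> raises k F -> raises k (E \o F).
Proof. exact: raises_comp. Qed.

Lemma raisesZ k (a : K) E : raises k E -> raises k (fun f => a *: E f).
Proof.
move=> [cE E1]; split; first exact: continuous_endoZ.
by move=> j f /E1; apply: order_geZ.
Qed.

Lemma raises_iter k E i : raises k E -> raises (i * k) (iter i E).
Proof.
move=> rE; elim: i => [|i IH]; first exact: raises_id.
by rewrite mulSn; apply: raises_comp.
Qed.

Lemma raises_endo_order k E :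
  continuous_endo E -> endo_order k.+1 E -> raises k E.
Proof.
move=> cE oE; apply/endo_geP; split=> // j f /oE; exact: has_order_ge.
Qed.

(** The image of a monomial is homogeneous, yet vanishes in its own order, so it is zero. Identities
    between homogeneous endomorphisms are proved below by checking them up to terms of higher
    order. *)
Lemma raises_endo_order_eq0 k E :
  endo_order k.+1 E -> raises k.+1 E -> E = 0.
Proof.
move=> oE [cE E1]; apply: funext; apply: continuous_endo_mono_eq0 => // t.
have ht := @has_order_mono K V t; have ho := oE _ _ ht.
rewrite addnS /= in ho; apply: has_order_order_ge_eq0 ho _.
by rewrite -addnS; apply: E1; apply: has_order_ge ht.
Qed.

(* The component of order [k.+1], meant for an [E] in the module [(k.+1)]. *)
Definition lead k E f : L :=
  lie_glue (fun i => if (i < k)%N then 0 else E (order_part (i - k)%N f)).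

Lemma leadE k E f w : lead k E f w =
  if (size w < k)%N then 0 else E (order_part (size w - k)%N f) w.
Proof. by rewrite lie_glueE; case: ifP. Qed.

Lemma lead_order k E : linear E -> endo_order k.+1 (lead k E).
Proof.
move=> lE j f fj w; rewrite addnS succnK => wj; rewrite leadE.
case: ltnP => // kw; rewrite (order_part_neq _ fj) ?linearE_0 //.
by apply: contraNneq wj => <-; rewrite subnK.
Qed.

Lemma lead_cont k E : continuous_endo E -> continuous_endo (lead k E).
Proof.
move=> [lE cE]; split=> [a f g|w].
  apply: lie_eqP => w; rewrite lieDE lieZE !leadE.
  case: ifP => _; first by rewrite mulr0 addr0.
  by rewrite order_part_linear lE.
have [s sE] := cE w; exists s => f f0; rewrite leadE; case: ifP => // _.
by apply: sE => u us; rewrite order_partE f0 //; case: ifP.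
Qed.

(** On a homogeneous argument of order [j], [lead] keeps exactly the part of [E f] of length
    [j + k], the lowest that can occur. *)
Lemma raises_sub_lead k E : raises k E -> raises k.+1 (E - lead k E).
Proof.
move=> [cE E1]; have cl := lead_cont k cE; have [lE _] := cE.
apply/endo_geP; split; first exact: continuous_endoB.
move=> j f fj w; rewrite !addnS succnK ltnS leq_eqVlt endoBE lieBE.
case/orP => [/eqP wjk|wjk].
  by rewrite leadE wjk ltnNge leq_addl addnK order_part_id // subrr.
rewrite (lead_order lE fj) ?subr0 ?addnS /=; last by rewrite ltn_eqF.
by apply: (E1 j) => //; apply: has_order_ge fj.
Qed.

Lemma raises_lead k E : raises k E -> raises k (lead k E).
Proof.
move=> rE; apply: raises_endo_order; first exact: lead_cont (raises_cont rE).
exact: lead_order (raises_linear rE).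
Qed.

Lemma lead_unique k E F : raises k E -> endo_order k.+1 F ->
  raises k.+1 (F - E) -> F = lead k E.
Proof.
move=> rE oF rFE; apply/eqP; rewrite -subr_eq0; apply/eqP.
apply: (@raises_endo_order_eq0 k).
  by apply: endo_orderB => //; apply: lead_order (raises_linear rE).
have -> : F - lead k E = (F - E) + (E - lead k E).
  by rewrite addrA subrK.
exact: raisesD (raises_sub_lead rE).
Qed.

(** If each [E k] raises the order by [k], the terms with [k >= i] vanish on words of length [i],
    since every Lie series has order at least 1. The cutoff [k < i] then yields the full sum. *)
Definition endo_series (E : nat -> L -> L) f : L :=
  lie_glue (fun i => \sum_(k < i) E k f).

Lemma endo_series_coef (E : nat -> L -> L) f w N :
  (forall k, raises k (E k)) -> (size w <= N)%N ->
  endo_series E f w = \sum_(k < N) E k f w.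
Proof.
move=> rE wN; rewrite lie_glueE lie_sum_coef.
rewrite -(big_mkord xpredT (fun k => E k f w)).
rewrite -(big_mkord xpredT (fun k => E k f w)) [RHS](big_cat_nat (leq0n _) wN).
rewrite [X in _ = _ + X]big_nat [X in _ = _ + X]big1 ?addr0 //.
move=> k /andP [wk _].
by have [_ /(_ _ _ (order_ge1 f))] := rE k; apply; rewrite add1n ltnS.
Qed.

Lemma endo_series_approx (E : nat -> L -> L) f N :
  (forall k, raises k (E k)) ->
  order_ge N.+1 (endo_series E f - \sum_(k < N) E k f).
Proof.
move=> rE w wN; rewrite lieBE lie_sum_coef (@endo_series_coef E f w N) //.
by rewrite subrr.
Qed.

Lemma endo_series_cont (E : nat -> L -> L) :
  (forall k, raises k (E k)) -> continuous_endo (endo_series E).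
Proof.
move=> rE; split=> [a f g|w].
  apply: lie_eqP => w; rewrite lieDE lieZE !lie_glueE !lie_sum_coef mulr_sumr.
  rewrite -big_split; apply: eq_bigr => k _.
  by rewrite (raises_linear (rE k)) lieDE lieZE.
have [_ /(_ w) [s sP]] : continuous_endo (\sum_(k < size w) E k).
  by apply: (@raises_cont 0); apply: raises_sum => k _; apply: raises_leq (rE k).
by exists s => f /sP; rewrite lie_glueE fct_sumE.
Qed.

Lemma raises_endo_series_tail (E : nat -> L -> L) N c :
  (forall k, raises k (E k)) -> (forall k, (N <= k)%N -> raises c (E k)) ->
  raises c (endo_series E - \sum_(k < N) E k).
Proof.
move=> rE rc; split.
  apply: continuous_endoB; first exact: endo_series_cont.
  by apply: (@raises_cont 0); apply: raises_sum => k _; apply: raises_leq (rE k).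
move=> j f fj w wj; rewrite endoBE lieBE fct_sumE lie_sum_coef.
(* This cutoff is large enough to compute the coefficient at [w], and at least [N], so that the
   subtracted partial sum cancels. *)
rewrite (@endo_series_coef E f w (maxn N (size w))) ?leq_maxr //.
rewrite -(big_mkord xpredT (fun k => E k f w)).
rewrite -(big_mkord xpredT (fun k => E k f w)) 
  (big_cat_nat (leq0n _) (leq_maxl _ _)).
rewrite addrAC subrr add0r big_nat big1 // => k /andP [Nk _].
by have [_ H] := rc k Nk; apply: H fj _ wj.
Qed.

Lemma endo_series_post (E : nat -> L -> L) F f N :
  (forall k, raises k (E k)) -> raises 0 F ->
  order_ge N.+1 (F (endo_series E f) - \sum_(k < N) F (E k f)).
Proof.
move=> rE rF; have lF := raises_linear rF.
rewrite -linearE_sum // -linearE_B // -[N.+1]addn0.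
by have [_] := rF; apply; apply: endo_series_approx.
Qed.

(** * Inversion of unipotent endomorphisms *)

Section Neumann.
Variable E : L -> L.
Hypothesis E_unipotent : raises 1 (E - id).

Let N : L -> L := - (E - id).
Let rN : raises 1 N. Proof. exact: raisesN. Qed.
Let rNk k : raises k (iter k N).
Proof. by have := raises_iter k rN; rewrite muln1. Qed.
Let EN f : E f = f - N f.
Proof. by rewrite /N opprB endoBE opprB addrC subrK. Qed.

(** With [E] written as [id - N], this is the geometric series in [N], which converges because [N]
    raises the order. *)
Definition neumann : L -> L := endo_series (fun k => iter k (- (E - id))).

Lemma neumann_cont : continuous_endo neumann.
Proof. exact: endo_series_cont. Qed.

Let order_ge_inf f : (forall P, order_ge P f) -> f = 0.
Proof. by move=> H; apply: lie_eqP => w; apply: (H (size w).+1). Qed.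

Let telescope f P : \sum_(k < P) iter k N f - \sum_(k < P) iter k.+1 N f
  = f - iter P N f.
Proof.
elim: P => [|P IH]; first by rewrite !big_ord0 /= !subrr.
rewrite !big_ord_recr opprD addrACA IH /= addrA subrK //.
Qed.

Let rest_order f P : order_ge P (iter P N f).
Proof.
by have [_ H] := rNk P; rewrite -[P]add0n; apply: H.
Qed.

Lemma neumannK : cancel neumann E.
Proof.
move=> f; apply/eqP; rewrite -subr_eq0; apply/eqP; apply: order_ge_inf => P.
have H1 := @endo_series_approx (fun k => iter k N) f P rNk.
have H2 := @endo_series_post (fun k => iter k N) N f P rNk
  (raises_leq (leq0n _) rN).
rewrite EN -[neumann f]/(endo_series (fun k => iter k N) f).
set x := endo_series _ _ in H1 H2 *.
(* Two truncation errors and the telescoping remainder are left, all of order at least [P]. *)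
have -> : x - N x - f = (x - \sum_(k < P) iter k N f)
  - (N x - \sum_(k < P) iter k.+1 N f) - iter P N f.
  have := telescope f P; move: (\sum_(k < P) _) (\sum_(k < P) _) => b a ab.
  by rewrite -[f in LHS](subrK (iter P N f)) -ab; lie_ring.
apply: order_geB; last exact: rest_order.
exact: order_ge_leq (leqnSn P) (order_geB H1 H2).
Qed.

Lemma neumannK' : cancel E neumann.
Proof.
move=> f; apply/eqP; rewrite -subr_eq0; apply/eqP; apply: order_ge_inf => P.
have H1 := @endo_series_approx (fun k => iter k N) (E f) P rNk.
rewrite -[neumann (E f)]/(endo_series (fun k => iter k N) (E f)).
set x := endo_series _ _ in H1 *.
have -> : x - f = (x - \sum_(k < P) iter k N (E f)) - iter P N f.
  have -> : \sum_(k < P) iter k N (E f) = f - iter P N f.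
    rewrite -telescope -sumrB; apply: eq_bigr => k _.
    by rewrite EN (linearE_B _ _ (raises_linear (rNk k))) -iterSr.
  lie_ring.
apply: order_geB; last exact: rest_order.
exact: order_ge_leq (leqnSn P) H1.
Qed.

End Neumann.

(** * The exponential of an order-raising endomorphism *)

Section Exponential.
Variable E : L -> L.

Definition dpow k f : L := invfact K k *: iter k E f.

Hypothesis rE : raises 1 E.
Let lE : linear E := raises_linear rE.

Lemma dpowS k f : k.+1%:R *: dpow k.+1 f = E (dpow k f).
Proof. by rewrite /dpow (linearE_Z _ _ lE) scalerA invfactS. Qed.

Lemma raises_dpow c k : raises c E -> raises (k * c) (dpow k).
Proof. by move=> rc; apply/raisesZ/raises_iter. Qed.

Let rd k : raises k (dpow k).
Proof. by have := raises_dpow k rE; rewrite muln1. Qed.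

Lemma dpow0 f : dpow 0 f = f.
Proof. by rewrite /dpow /invfact fact0 invr1 scale1r scale1r. Qed.

Lemma dpow1 f : dpow 1 f = E f.
Proof. by rewrite /dpow /invfact invr1 !scale1r. Qed.

(** Each coefficient of the partial sums is stationary from the length of its word on, so the limit
    selected by [xget] exists and is unique; the default 0 is never reached by accident. *)
Lemma lie_expE : lie_exp E = endo_series dpow.
Proof.
apply: funext => f; apply: xget_unique => [w|g gP].
  exists (size w) => M wM.
  by rewrite lie_sum_coef (@endo_series_coef dpow f w M rd wM).
apply: lie_eqP => w; have [N NP] := gP w.
rewrite -(NP (maxn N (size w)) (leq_maxl _ _)).
by rewrite lie_sum_coef (@endo_series_coef dpow f w _ rd (leq_maxr N (size w))).
Qed.

Lemma lie_exp_cont : continuous_endo (lie_exp E).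
Proof. by rewrite lie_expE; apply: endo_series_cont. Qed.

Lemma raises_lie_exp1 : raises 1 (lie_exp E - id).
Proof.
have := @raises_endo_series_tail dpow 1 1 rd (fun k k1 => raises_leq k1 (rd k)).
rewrite lie_expE big_ord1; have -> : dpow 0 = id by apply/funext/dpow0.
by [].
Qed.

(** The remaining terms have index [k >= 2] and raise the order by [k * c]. *)
Lemma raises_lie_exp2 c : raises c E -> raises c.*2 (lie_exp E - id - E).
Proof.
move=> rc; have := @raises_endo_series_tail dpow 2 c.*2 rd.
rewrite lie_expE big_ord_recl big_ord1 /=.
have -> : dpow 0 = id by apply/funext/dpow0.
have -> : dpow 1 = E by apply/funext/dpow1.
rewrite opprD addrA; apply=> k k2; apply: raises_leq (raises_dpow k rc).
by rewrite -mul2n leq_mul2r k2 orbT.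
Qed.

(** A bound on the plain commutator passes to powers by [[E^(k+1), F] = E [E^k, F] + [E, F] E^k],
    and then to the series one coefficient at a time. *)
Lemma lie_exp_commute F c : raises 0 F ->
  raises c ((E \o F) - (F \o E)) ->
  raises c ((lie_exp E \o F) - (F \o lie_exp E)).
Proof.
move=> rF rC; have lF := raises_linear rF.
have ri k : raises c ((iter k E \o F) - (F \o iter k E)).
  elim: k => [|k IH]; first by rewrite subrr; apply: raises0.
  have -> : (iter k.+1 E \o F) - (F \o iter k.+1 E) =
    (E \o ((iter k E \o F) - (F \o iter k E)))
    + (((E \o F) - (F \o E)) \o iter k E).
    apply: funext => f; rewrite endoBE endoDE !endo_compE !endoBE !endo_compE.
    by rewrite (linearE_B _ _ lE) -!iterS; lie_ring.
  apply: raisesD; first exact: raises_leq (raises_comp rE IH).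
  have := raises_comp rC (raises_iter k rE); apply: raises_leq.
  by rewrite leq_addr.
split.
  have c0 := raises_cont rF.
  by apply: continuous_endoB; apply: continuous_endo_comp => //;
    apply: lie_exp_cont.
move=> j f fj; rewrite lie_expE endoBE /=.
move=> w wj.
have H1 := @endo_series_approx dpow (F f) (size w) rd.
have H2 := @endo_series_post dpow F f (size w) rd rF.
set S1 := \sum_(k < _) _ in H1; set S2 := \sum_(k < _) _ in H2.
set X := endo_series _ _ in H1 *; set Y := F (endo_series _ _) in H2 *.
have -> : X - Y = (X - S1 - (Y - S2)) + (S1 - S2) by lie_ring.
rewrite (lieDE (X - S1 - (Y - S2))) (order_geB H1 H2) // add0r /S1 /S2 -sumrB.
apply: (order_ge_sum (n := j + c)) wj => k _.
rewrite /dpow (linearE_Z _ _ lF) -scalerBr; apply: order_geZ.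
by have [_ H] := ri k; apply: H.
Qed.

Hypothesis derE : forall f g,
  E (lie_bracket f g) = lie_bracket (E f) g + lie_bracket f (E g).

Lemma dpow_bracket k f g : dpow k (lie_bracket f g) =
  \sum_(i < k.+1) lie_bracket (dpow i f) (dpow (k - i) g).
Proof.
elim: k => [|k IH]; first by rewrite big_ord1 !dpow0.
(* Multiplication by [k + 1] is injective over the rationals and clears the denominator between
   consecutive divided powers. *)
apply: lie_eqP => w; apply: (@natr_lregK _ k).
rewrite -[_ * dpow _ _ _]lieZE dpowS IH linearE_sum // -lieZE.
congr (lie_val _ w).
(* The weight [k + 1] is split as [i + (k + 1 - i)], one share for each factor that [E]
   differentiates. *)
transitivity (\sum_(i < k.+2) (i%:R *: lie_bracket (dpow i f) (dpow (k.+1 - i) g)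
   + (k.+1 - i)%:R *: lie_bracket (dpow i f) (dpow (k.+1 - i) g))).
  rewrite [RHS]big_split /= [X in _ = X + _]big_ord_recl scale0r add0r.
  rewrite [X in _ = _ + X]big_ord_recr /= subnn scale0r addr0 -big_split /=.
  apply: eq_bigr => i _; rewrite derE -!dpowS lie_bracketZl lie_bracketZr.
  by rewrite /bump /= add1n subSS subSn // -ltnS.
rewrite scaler_sumr; apply: eq_bigr => i _.
by rewrite -scalerDl -natrD subnKC // -ltnS.
Qed.

Let sum_triangle (T : nat -> nat -> L) N :
  \sum_(i < N) \sum_(j < N - i) T i j
  = \sum_(k < N) \sum_(i < k.+1) T i (k - i)%N.
Proof.
elim: N => [|N IH]; first by rewrite !big_ord0.
rewrite [RHS]big_ord_recr /= -IH [in RHS]big_ord_recr /= subnn addrA -big_split.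
rewrite big_ord_recr /= subSnn big_ord1; congr (_ + _).
by apply: eq_bigr => i _; rewrite subSn ?big_ord_recr // ltnW.
Qed.

(** On words of length [N] both series may be cut at [N]. The binomial formula accounts for the
    brackets with [i + j < N]; the other brackets of the two partial sums have order at least
    [i + j + 2] and vanish there. *)
Lemma lie_exp_bracket f g :
  lie_exp E (lie_bracket f g) = lie_bracket (lie_exp E f) (lie_exp E g).
Proof.
rewrite lie_expE; apply: lie_eqP => w; set N := size w.
rewrite (@endo_series_coef dpow _ w _ rd (leqnn _)) -/N.
set S := fun f => \sum_(k < N) dpow k f.
have approx h : order_ge N.+1 (endo_series dpow h - S h).
  exact: endo_series_approx.
have -> : lie_bracket (endo_series dpow f) (endo_series dpow g) w
  = lie_bracket (S f) (S g) w.
  have -> : lie_bracket (endo_series dpow f) (endo_series dpow g) =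
     lie_bracket (endo_series dpow f - S f) (endo_series dpow g)
     + lie_bracket (S f) (endo_series dpow g - S g) + lie_bracket (S f) (S g).
    by rewrite lie_bracketBl lie_bracketBr; lie_ring.
  have o1 := order_ge_bracket (approx f) (order_ge1 (endo_series dpow g)).
  have o2 := order_ge_bracket (order_ge1 (S f)) (approx g).
  by rewrite !lieDE o1 ?o2 ?add0r //; rewrite /N; lia.
rewrite -lie_sum_coef; under eq_bigr do rewrite dpow_bracket.
rewrite -(sum_triangle (fun i j => lie_bracket (dpow i f) (dpow j g))).
rewrite lie_bracket_suml !lie_sum_coef; apply: eq_bigr => i _.
rewrite lie_bracket_sumr !lie_sum_coef.
rewrite -(big_mkord xpredT (fun j => lie_bracket (dpow i f) (dpow j g) w)).
rewrite -(big_mkord xpredT (fun j => lie_bracket (dpow i f) (dpow j g) w)).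
rewrite [RHS](big_cat_nat (leq0n _) (leq_subr i N)).
rewrite [X in _ = _ + X]big_nat [X in _ = _ + X]big1 ?addr0 //.
move=> j /andP [ij _].
have [_ /(_ _ _ (order_ge1 f)) of1] := rd i.
have [_ /(_ _ _ (order_ge1 g)) og1] := rd j.
by apply: (order_ge_bracket of1 og1); move: ij; rewrite /N; lia.
Qed.

End Exponential.
End Raising.

(** * Degrees and vector fields *)

Section Grading.
Variables (K : comAlgType rat) (gr : even_grading K).

Lemma gr_pieceN d a : gr d a -> gr d (- a).
Proof. by move=> da; rewrite -sub0r; apply: gr_pieceB => //; apply: gr_piece0. Qed.

Lemma gr_pieceD d a b : gr d a -> gr d b -> gr d (a + b).
Proof. by move=> da db; rewrite -[b]opprK; apply/gr_pieceB/gr_pieceN. Qed.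

Lemma gr_piece_sum d (I : Type) (r : seq I) (P : pred I) (F : I -> K) :
  (forall i, P i -> gr d (F i)) -> gr d (\sum_(i <- r | P i) F i).
Proof.
move=> H; elim/big_ind: _ => //; first exact: gr_piece0.
by move=> x y; apply: gr_pieceD.
Qed.

Lemma gr_piece_muln d a n : gr d a -> gr d (a *+ n).
Proof.
move=> da; elim: n => [|n IH]; first exact: gr_piece0.
by rewrite mulrS; apply: gr_pieceD.
Qed.

Lemma gr_piece_sign d a n : gr d a -> gr d ((-1) ^+ n * a).
Proof.
move=> da; rewrite -signr_odd; case: (odd n); rewrite ?expr1 ?mulN1r ?mul1r //.
exact: gr_pieceN.
Qed.

(* Comparing components of degree [d != 0] in [N * a = 1] shows that the inverse
   [a] of [N] has degree zero. *)
Lemma gr_invn n : gr 0 ((n.+1%:R^-1 : rat)%:A).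
Proof.
set a : K := _%:A.
have Na : n.+1%:R * a = 1.
  rewrite -natr_alg /a -scalerAl mul1r scalerA mulfV ?scale1r //.
  by rewrite Num.Theory.pnatr_eq0.
have [s [c [cP aE]]] := gr_decomp gr a.
(* [gr_decomp] may list a degree repeatedly: [b] counts multiplicities, and prepending 0 guarantees
   a term of degree zero. *)
pose r := undup (0 :: s); pose b d := c d *+ count_mem d s.
have ab : a = \sum_(d <- r) b d.
  have bs : a = \sum_(d <- undup s) b d by rewrite aE -big_undup_iterop_count.
  rewrite {}bs /r /=; case: ifP => // s0; rewrite big_cons /b.
  by rewrite (count_memPn _) ?s0 // mulr0n add0r.
have bP d : gr d (b d) by apply: gr_piece_muln.
have rU : uniq r := undup_uniq _.
have r0 : 0 \in r by rewrite mem_undup inE eqxx.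
have b0 d : d \in r -> n.+1%:R * b d - (d == 0)%:R = 0.
  move: d; apply: (gr_direct rU).
    move=> d; apply: gr_pieceB; first by rewrite mulr_natl; apply: gr_piece_muln.
    by case: eqP => [->|_]; [exact: gr_piece1|exact: gr_piece0].
  rewrite sumrB -mulr_sumr -ab Na (bigD1_seq (0 : int)) //= big1 ?addr0 ?subrr //.
  by move=> i /negbTE ->.
rewrite ab (bigD1_seq (0 : int)) //= big1_seq ?addr0 //.
move=> d /andP [/negbTE dn0 dr]; apply: (@natr_lregK _ n).
by have := b0 d dr; rewrite dn0 subr0 mulr0.
Qed.

Lemma gr_invfact k : gr 0 (invfact K k).
Proof. by rewrite /invfact -(prednK (fact_gt0 k)); apply: gr_invn. Qed.

(** * Degrees of Lie series and of their endomorphisms *)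

Section LieDegree.
Variable V : free_graded.
Local Notation L := (lie K V).
Implicit Types (f g : L) (E F : L -> L) (t : lie_tree V).

Lemma wdeg_cat (u v : word V) : wdeg (u ++ v) = wdeg u + wdeg v.
Proof. exact: big_cat. Qed.

Lemma lie_degB d f g : lie_deg gr d f -> lie_deg gr d g -> lie_deg gr d (f - g).
Proof. by move=> df dg w; rewrite lieBE; apply: gr_pieceB. Qed.

Lemma lie_degD d f g : lie_deg gr d f -> lie_deg gr d g -> lie_deg gr d (f + g).
Proof. by move=> df dg w; rewrite lieDE; apply: gr_pieceD. Qed.

Lemma lie_degZ d a f : gr 0 a -> lie_deg gr d f -> lie_deg gr d (a *: f).
Proof.
by move=> a0 df w; rewrite lieZE -[_ - _]add0r; apply: gr_pieceM.
Qed.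

Lemma lie_deg_sum d (I : Type) (r : seq I) (P : pred I) (F : I -> L) :
  (forall i, P i -> lie_deg gr d (F i)) ->
  lie_deg gr d (\sum_(i <- r | P i) F i).
Proof.
move=> H w; rewrite lie_sum_coef; apply: gr_piece_sum => i Pi; exact: H.
Qed.

Lemma lie_deg_glue d (h : nat -> L) :
  (forall n, lie_deg gr d (h n)) -> lie_deg gr d (lie_glue h).
Proof. by move=> H w; rewrite lie_glueE; apply: H. Qed.

Lemma lie_deg0 d : lie_deg gr d (0 : L).
Proof. by move=> w; rewrite lie0E; apply: gr_piece0. Qed.

Lemma lie_deg_part d j f : lie_deg gr d f -> lie_deg gr d (order_part j f).
Proof.
by move=> df; apply: lie_deg_glue => n; case: eqP => // _; apply: lie_deg0.
Qed.

Lemma lie_deg_bracket d e f g :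
  lie_deg gr d f -> lie_deg gr e g -> lie_deg gr (d + e) (lie_bracket f g).
Proof.
move=> df eg w; rewrite lie_bracketE; apply: gr_piece_sum => k _.
have wE : wdeg w = wdeg (take k w) + wdeg (drop k w).
  by rewrite -wdeg_cat cat_take_drop.
apply: gr_pieceB; last apply: gr_piece_sign.
  have -> : d + e - wdeg w = (d - wdeg (take k w)) + (e - wdeg (drop k w)).
    by rewrite wE; ring.
  exact: gr_pieceM.
have -> : d + e - wdeg w = (e - wdeg (take k w)) + (d - wdeg (drop k w)).
  by rewrite wE; ring.
exact: gr_pieceM.
Qed.

Lemma lie_deg_mono t : lie_deg gr (wdeg (leaves t)) (mono K t).
Proof.
elim: t => [i|t1 IH1 t2 IH2]; last first.
  by rewrite mono_node wdeg_cat; apply: lie_deg_bracket.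
move=> w; rewrite monoE /=; case: eqP => [->|_]; last exact: gr_piece0.
by rewrite subrr; apply: gr_piece1.
Qed.

Lemma endo_degree_lead p k E : endo_degree gr p E -> endo_degree gr p (lead k E).
Proof.
move=> dE d f df; apply: lie_deg_glue => i; case: ifP => _.
  exact: lie_deg0.
by apply: dE; apply: lie_deg_part.
Qed.

Lemma endo_degree_comp p q E F : endo_degree gr p E -> endo_degree gr q F ->
  endo_degree gr (q + p) (E \o F).
Proof. by move=> dE dF d f df; rewrite addrA; apply/dE/dF. Qed.

Lemma endo_degree_iter E k : endo_degree gr 0 E -> endo_degree gr 0 (iter k E).
Proof.
move=> dE; elim: k => [|k IH]; first by move=> d f; rewrite addr0.
exact: (endo_degree_comp dE IH).
Qed.

Lemma endo_degree_series (E : nat -> L -> L) :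
  (forall k, endo_degree gr 0 (E k)) -> endo_degree gr 0 (endo_series E).
Proof.
by move=> dE d f df; apply: lie_deg_glue => i; apply: lie_deg_sum => k _;
  apply: dE.
Qed.

Lemma endo_degreeB p E F : endo_degree gr p E -> endo_degree gr p F ->
  endo_degree gr p (E - F).
Proof.
by move=> dE dF d f df; apply: lie_degB; [apply: dE|apply: dF].
Qed.

Lemma endo_degree_id : endo_degree gr 0 (id : L -> L).
Proof. by move=> d f; rewrite addr0. Qed.

(** In degree 0 the Leibniz rule carries no sign, so both sides are continuous and linear in [f].
    Monomials are homogeneous, which extends the rule to inhomogeneous [f]. *)
Lemma vector_field_bracket0 E : vector_field gr 0 E -> forall f g,
  E (lie_bracket f g) = lie_bracket (E f) g + lie_bracket f (E g).
Proof.
move=> [cE _ bE] f g; have [lE _] := cE.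
pose D := ((E \o (fun f => lie_bracket f g)) - ((fun f => lie_bracket f g) \o E))
  - (fun f => lie_bracket f (E g)).
have cD : continuous_endo D.
  apply: continuous_endoB; last exact: continuous_bracketl.
  by apply: continuous_endoB; apply: continuous_endo_comp => //;
    apply: continuous_bracketl.
have DE h : D h = E (lie_bracket h g) - lie_bracket (E h) g
  - lie_bracket h (E g) by [].
apply/eqP; rewrite -subr_eq0 opprD addrA -DE; apply/eqP.
apply: continuous_endo_mono_eq0 => // t.
rewrite DE (bE _ _ _ (lie_deg_mono t)) mul0r expr0 scale1r; lie_ring.
Qed.

(** The Leibniz rule gives this by induction on trees, starting from the fact that no Lie series has
    a constant term. *)
Lemma raises_vector_field p E : vector_field gr p E -> raises 0 E.
Proof.
move=> [cE _ bE]; split=> // j f; rewrite addn0; apply: order_ge_mono_ext => //.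
move=> t jt; apply: order_ge_leq jt _; elim: t => [i|t1 IH1 t2 IH2].
  exact: order_ge1.
rewrite mono_node (bE _ _ _ (lie_deg_mono t1)); apply: order_geD.
  exact: order_ge_bracket IH1 (has_order_ge (leqnn _) (@has_order_mono K V t2)).
apply: order_geZ.
exact: order_ge_bracket (has_order_ge (leqnn _) (@has_order_mono K V t1)) IH2.
Qed.

Lemma raises_lie_hom E : lie_hom gr E -> raises 0 E.
Proof.
move=> [cE _ bE]; split=> // j f; rewrite addn0; apply: order_ge_mono_ext => //.
move=> t jt; apply: order_ge_leq jt _; elim: t => [i|t1 IH1 t2 IH2].
  exact: order_ge1.
by rewrite mono_node bE; apply: order_ge_bracket.
Qed.

Lemma vector_fieldD k E F :
  vector_field gr k E -> vector_field gr k F -> vector_field gr k (E + F).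
Proof.
move=> vE vF; rewrite -[F]opprK -[- F]sub0r.
by do 2 ?[apply: vector_fieldB => //]; apply: vector_field0.
Qed.

Lemma vector_field_sum k (I : Type) (r : seq I) (P : pred I) (F : I -> L -> L) :
  (forall i, P i -> vector_field gr k (F i)) ->
  vector_field gr k (\sum_(i <- r | P i) F i).
Proof.
move=> H; elim/big_ind: _ => //; first exact: vector_field0.
exact: vector_fieldD.
Qed.

Lemma sign_absz_succ (d : int) :
  (-1) ^+ `|(d + 1)%R|%N = - (-1) ^+ `|d|%N :> K.
Proof.
rewrite -signr_odd -[in RHS]signr_odd.
have -> : odd `|(d + 1)%R|%N = ~~ odd `|d|%N by lia.
by case: (odd _); rewrite ?expr1 ?expr0 ?opprK.
Qed.

Lemma commutatorE E F f : commutator 1 (-1) E F f = E (F f) + F (E f).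
Proof.
have -> : commutator 1 (-1) E F f = E (F f) - (-1) ^+ 1 *: F (E f) by [].
by rewrite expr1 scaleN1r opprK.
Qed.

Lemma vector_field_commutator E F : vector_field gr 1 E ->
  vector_field gr (-1) F -> vector_field gr 0 (commutator 1 (-1) E F).
Proof.
move=> [cE dE bE] [cF dF bF].
have [[lE _] [lF _]] := (cE, cF).
have -> : commutator 1 (-1) E F = (E \o F) + (F \o E).
  by apply: funext => f; rewrite commutatorE.
split.
- by apply: continuous_endoD; apply: continuous_endo_comp.
- move=> d f df; rewrite endoDE !endo_compE; apply: lie_degD.
    by rewrite -[d + 0]/(d + (-1 + 1)) addrA; apply/dE/dF.
  by rewrite -[d + 0]/(d + (1 + -1)) addrA; apply/dF/dE.
- move=> d f g df; rewrite !endoDE !endo_compE mul0r expr0 scale1r.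
  rewrite (bF d) // (bE d) //.
  rewrite (linearE_D _ _ lE) (linearE_D _ _ lF) (linearE_Z _ _ lE).
  rewrite (linearE_Z _ _ lF) (bE _ _ _ (dF _ _ df)) (bF _ _ _ (dE _ _ df)).
  rewrite (bE d) // (bF d) // !mul1r !mulN1r !abszN.
  (* Both shifts [d + 1] and [d - 1] flip the sign, so the mixed terms cancel. *)
  rewrite sign_absz_succ.
  have -> : (-1) ^+ `|(d + -1)%R|%N = - (-1) ^+ `|d|%N :> K.
    by rewrite -[in RHS](subrK 1 d) sign_absz_succ opprK.
  have ss : (-1) ^+ `|d|%N * (-1) ^+ `|d|%N = 1 :> K by rewrite -expr2 sqrr_sign.
  rewrite !scalerDr !scalerA ss !scale1r !lie_bracketDl !lie_bracketDr !scaleNr.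
  lie_ring.
Qed.

(** The Leibniz rule is only required up to higher order: a difference of two homomorphisms need not
    be a derivation, but its lowest component can still be one. *)
Lemma lead_vector_field k p E : raises k E -> endo_degree gr p E ->
  (forall d a b f g, lie_deg gr d f -> has_order a f -> has_order b g ->
     order_ge (a + b + k).+1 (E (lie_bracket f g) -
      (lie_bracket (E f) g + (-1) ^+ `|(p * d)%R|%N *: lie_bracket f (E g)))) ->
  vector_field gr p (lead k E).
Proof.
move=> rE dE bE; have cl := lead_cont k (raises_cont rE).
have lE := raises_linear rE; have [ll _] := cl.
split=> //; first exact: endo_degree_lead.
move=> d f g df; set s := _ ^+ _.
(* For homogeneous arguments both sides are homogeneous of order [a + b + k], so agreement up to
   higher order suffices. *)
have hom a b f' g' : lie_deg gr d f' -> has_order a f' -> has_order b g' ->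
    lead k E (lie_bracket f' g')
    = lie_bracket (lead k E f') g' + s *: lie_bracket f' (lead k E g').
  move=> df' af bg; have af1 := has_order_ge (leqnn a) af.
  have bg1 := has_order_ge (leqnn b) bg.
  have fg1 := order_ge_bracket af1 bg1.
  apply/eqP; rewrite -subr_eq0; apply/eqP.
  apply: (@has_order_order_ge_eq0 _ _ (a + b + k)).
    have o x j : has_order j x -> has_order (j + k) (lead k E x).
      by move=> jx; have := @lead_order _ _ k E lE j x jx; rewrite addnS.
    apply: has_orderB; first by apply: o; apply: has_order_bracket.
    apply: has_orderD; first by rewrite addnAC;
      apply: has_order_bracket (o _ _ af) bg.
    move=> w wn; rewrite lieZE (has_order_bracket af (o _ _ bg)) ?mulr0 //.
    by rewrite addnA.
  have [_ R] := raises_sub_lead rE.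
  pose r x := (E - lead k E) x.
  have rP x : lead k E x = E x - r x by rewrite /r endoBE; lie_ring.
  have r1 : order_ge (a + b + k).+1 (r (lie_bracket f' g')).
    by rewrite -addnS; apply: R.
  have r2 : order_ge (a + b + k).+1 (lie_bracket (r f') g').
    by rewrite addnAC -addSn -addnS; apply: order_ge_bracket bg1; apply: R.
  have r3 : order_ge (a + b + k).+1 (lie_bracket f' (r g')).
    by rewrite -addnA -!addnS; apply: order_ge_bracket => //; apply: R.
  have := order_geD (order_geB (bE _ _ _ _ _ df' af bg) r1)
    (order_geD r2 (order_geZ s r3)).
  rewrite !rP lie_bracketBl lie_bracketBr -/s; congr order_ge; lie_ring.
(* Continuity extends the rule first in [f], through components that still have degree [d], and then
   in [g]. *)
have hom1 b g' : has_order b g' -> lead k E (lie_bracket f g')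
    = lie_bracket (lead k E f) g' + s *: lie_bracket f (lead k E g').
  move=> bg.
  pose D := ((lead k E \o (fun f => lie_bracket f g'))
    - ((fun f => lie_bracket f g') \o lead k E))
    - (fun f => s *: lie_bracket f (lead k E g')).
  have cD : continuous_endo D.
    apply: continuous_endoB; last exact/continuous_endoZ/continuous_bracketl.
    by apply: continuous_endoB; apply: continuous_endo_comp => //;
      apply: continuous_bracketl.
  have DE h : D h = lead k E (lie_bracket h g') - lie_bracket (lead k E h) g'
    - s *: lie_bracket h (lead k E g') by [].
  apply/eqP; rewrite -subr_eq0 opprD addrA -DE; apply/eqP.
  apply: continuous_endo_part_eq0 => // j; rewrite DE.
  rewrite (hom j b) //; first lie_ring; first exact: lie_deg_part.
  exact: has_order_part.
pose D := ((lead k E \o (fun g => lie_bracket f g))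
    - (fun g => lie_bracket (lead k E f) g))
    - (fun g => s *: lie_bracket f (lead k E g)).
have cZ : continuous_endo (fun g => s *: lie_bracket f (lead k E g)).
  apply: continuous_endoZ.
  exact: continuous_endo_comp (continuous_bracketr f) cl.
have cD : continuous_endo D.
  apply: continuous_endoB => //; apply: continuous_endoB.
    by apply: continuous_endo_comp => //; apply: continuous_bracketr.
  exact: continuous_bracketr.
have DE h : D h = lead k E (lie_bracket f h) - lie_bracket (lead k E f) h
    - s *: lie_bracket f (lead k E h) by [].
apply/eqP; rewrite -subr_eq0 opprD addrA -DE; apply/eqP.
apply: continuous_endo_part_eq0 => // j; rewrite DE.
by rewrite (hom1 j) //; [lie_ring|exact: has_order_part].
Qed.

Lemma lead_vector_field_exact k p E :
  raises k E -> vector_field gr p E -> vector_field gr p (lead k E).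
Proof.
move=> rE [_ dE bE]; apply: lead_vector_field => // d a b f g df _ _.
by rewrite (bE d) // subrr; apply: order_ge0.
Qed.

Lemma lie_exp_hom E :
  vector_field gr 0 E -> raises 1 E -> lie_hom gr (lie_exp E).
Proof.
move=> vE rE; have [_ dE _] := vE; split; first exact: lie_exp_cont.
  rewrite lie_expE //; apply: endo_degree_series => k d f df.
  by apply: lie_degZ (gr_invfact k) _; apply: endo_degree_iter.
by move=> f g; apply: lie_exp_bracket => //; apply: vector_field_bracket0.
Qed.

(** The Neumann series inverts [E]. It preserves brackets as the inverse of a homomorphism, and
    degrees because it is built from iterates of a map of degree zero. *)
Lemma unipotent_diffeo E : lie_hom gr E -> raises 1 (E - id) ->
  exists psi : diffeo gr V, psi = E :> (L -> L).
Proof.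
move=> hE rE; have [cE dE bE] := hE.
have EK := neumannK' rE; have KE := neumannK rE.
suff hI : lie_hom gr (neumann E) by exists (Diffeo hE hI EK KE).
split; first exact: neumann_cont.
  apply: endo_degree_series => k; apply: endo_degree_iter.
  rewrite -sub0r; apply: endo_degreeB; first by case: (vector_field0 gr V 0).
  by apply: endo_degreeB => //; apply: endo_degree_id.
by move=> f g; rewrite -{1}[f]KE -{1}[g]KE -bE EK.
Qed.

Lemma lie_hom_comp E F : lie_hom gr E -> lie_hom gr F -> lie_hom gr (E \o F).
Proof.
move=> [cE dE bE] [cF dF bF]; split; first exact: continuous_endo_comp.
  exact: (endo_degree_comp dE dF).
by move=> f g; rewrite !endo_compE bF bE.
Qed.

(** * Pointed diffeomorphisms and conjugation *)

Section Diffeomorphisms.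
Variable phi : diffeo gr V.

Lemma raises_diffeo : raises 0 phi.
Proof. exact: raises_lie_hom (dfun_hom phi). Qed.

Lemma raises_dinv : raises 0 (dinv phi).
Proof. exact: raises_lie_hom (dinv_hom phi). Qed.

(** Each coefficient of [phi f - f] is a finite sum of coefficients of [phis i f] with [i >= 2], and
    these maps raise the order by at least 1. *)
Lemma raises_pointed : pointed phi -> raises 1 (dfun phi - id).
Proof.
move=> [phis [phisP lim]].
have [[cphi _] [cid _]] := (raises_diffeo, raises_id K V).
split; first exact: continuous_endoB.
move=> j f fj w wj; have [N /(_ N (leqnn N)) NP] := lim f w.
rewrite endoBE lieBE -NP lieDE addrAC subrr add0r lie_sum_coef big_nat big1 //.
move=> i /andP [i2 _]; have [ci oi] := phisP i i2.
have [|_ H] := @raises_endo_order K V i.-1 (phis i) ci.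
  by rewrite prednK // ltnW.
by apply: H fj _ _; move: wj; lia.
Qed.

Lemma raises_dinv_pointed : raises 1 (dfun phi - id) -> raises 1 (dinv phi - id).
Proof.
move=> rphi; have -> : dinv phi - id = - ((dfun phi - id) \o dinv phi).
  apply: funext => f; rewrite /= -[(- _) f]/(- ((dfun phi - id) (dinv phi f))).
  by rewrite !endoBE dinvK opprB.
by apply: raisesN; have := raises_comp rphi raises_dinv; rewrite addn0.
Qed.

Lemma vector_field_conj p E :
  vector_field gr p E -> vector_field gr p (phi \o E \o dinv phi).
Proof.
move=> [cE dE bE]; have [cp dp bp] := dfun_hom phi.
have [ci di bi] := dinv_hom phi.
split; first by do 2 apply: continuous_endo_comp => //.
  move=> d f df; rewrite -[d + p]addr0 !endo_compE; apply/dp/dE.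
  by rewrite -[d]addr0; apply: di.
move=> d f g df; rewrite !endo_compE bi (bE d); last first.
  by rewrite -[d]addr0; apply: di.
have [lp _] := cp.
by rewrite (linearE_D _ _ lp) (linearE_Z _ _ lp) !bp !dinvK.
Qed.

End Diffeomorphisms.
End LieDegree.
End Grading.

(** * The obstruction *)

Definition endoE := (endoBE, endoDE, endo_compE).

Section Obstruction.
Variables (K : comAlgType rat) (gr : even_grading K) (V : free_graded).
Local Notation L := (lie K V).
Implicit Types (f g : L) (E F : L -> L).

(** * Order estimates for minimal structures *)

Section Structure.
Variables (n : nat) (m : Cn_structure gr V n).

Lemma Cn_field_vector_field : vector_field gr 1 (Cn_field m).
Proof.
rewrite /Cn_field big_nat; apply: vector_field_sum => i.
exact: Cn_part_field.
Qed.

Lemma raises_Cn_part k i : (k < i)%N -> raises k (Cn_part m i).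
Proof.
move=> ki; have [hi|hi] := boolP (2 <= i < n)%N; last first.
  by rewrite Cn_part_out //; apply: raises0.
apply: (raises_leq (k := i.-1)).
  by rewrite -ltnS prednK ?(leq_ltn_trans _ ki).
apply: raises_endo_order; first by case: (Cn_part_field m hi).
by rewrite prednK ?(leq_ltn_trans _ ki) //; apply: Cn_part_order.
Qed.

Lemma raises_Cn_field : raises 1 (Cn_field m).
Proof.
rewrite /Cn_field big_nat; apply: raises_sum => i /andP [i2 _].
exact: raises_Cn_part.
Qed.

Lemma raises_Cn_square : raises n (Cn_field m \o Cn_field m).
Proof.
have sq : eqmod n.+1 (Cn_field m \o Cn_field m) 0 := Cn_square m.
by move/endo_eqmodP: sq; rewrite subr0.
Qed.

Lemma Cn_field_sub_mul : (2 < n)%N -> raises 2 (Cn_field m - Cn_part m 2).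
Proof.
move=> n2; rewrite /Cn_field big_ltn // addrAC subrr add0r big_nat.
apply: raises_sum => i /andP [i2 _]; exact: raises_Cn_part.
Qed.

End Structure.

Lemma Cn_field_sub_trunc n (m : Cn_structure gr V n.+1) : (2 <= n)%N ->
  raises n.-1 (Cn_field m - Cn_field (Cn_trunc m)).
Proof.
move=> n2; rewrite /Cn_field big_nat_recr //=.
have -> : \sum_(2 <= i < n) trunc_part m i = \sum_(2 <= i < n) Cn_part m i.
  by apply: eq_big_nat => i hi; rewrite /trunc_part hi.
by rewrite addrAC subrr add0r; apply: raises_Cn_part; rewrite prednK // ltnW.
Qed.

(* The paper's n is p.+2. *)
Variables (A : sgc_algebra gr V) (p : nat).
Hypothesis p_gt0 : (0 < p)%N.
Variables (m m' : Cn_structure gr V p.+3).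
Hypotheses (hm : has_underlying_algebra m A).
Hypotheses (hm' : has_underlying_algebra m' A).

Let M := Cn_field m.
Let M' := Cn_field m'.
Let Mb := Cn_field (Cn_trunc m).
Let Mb' := Cn_field (Cn_trunc m').

Let rM : raises 1 M := raises_Cn_field m.
Let rM' : raises 1 M' := raises_Cn_field m'.
Let rMb : raises 1 Mb := raises_Cn_field (Cn_trunc m).
Let rMMb : raises p.+1 (M - Mb).
Proof. exact: Cn_field_sub_trunc. Qed.
Let rMMb' : raises p.+1 (M' - Mb').
Proof. exact: Cn_field_sub_trunc. Qed.
Let rMA : raises 2 (M - sgc_mul A).
Proof. by rewrite -hm; apply: Cn_field_sub_mul. Qed.
Let rMA' : raises 2 (M' - sgc_mul A).
Proof. by rewrite -hm'; apply: Cn_field_sub_mul. Qed.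
Let rA : raises 1 A.
Proof. by rewrite -hm; apply: raises_Cn_part. Qed.
Let lA : linear A := raises_linear rA.
Let lM : linear M := raises_linear rM.
Let lM' : linear M' := raises_linear rM'.

Let rM2 : raises p.+3 (M \o M) := raises_Cn_square m.
Let rM2' : raises p.+3 (M' \o M') := raises_Cn_square m'.
Let rMb2 : raises p.+2 (Mb \o Mb) := raises_Cn_square (Cn_trunc m).

(** * The obstruction of a single morphism *)

Section OneMorphism.
Variable phi : pointed_morphism (Cn_trunc m) (Cn_trunc m').

Let rphi : raises 1 (dfun phi - id) := raises_pointed (pm_pointed phi).
Let lphi : linear phi := raises_linear (raises_diffeo phi).

Definition obs_defect : L -> L := (phi \o M \o dinv phi) - M'.
Local Notation X := obs_defect.

Lemma raises_obs_defect : raises p.+1 X.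
Proof.
have := pm_morphism phi; rewrite /Cn_morphism => /endo_eqmodP rC.
(* The morphism condition controls the truncations; the dropped parts, of order [p.+2], raise the
   order by [p.+1] on their own. *)
have -> : X = (((phi \o Mb) - (Mb' \o phi)) + (phi \o (M - Mb))
   - ((M' - Mb') \o phi)) \o dinv phi.
  apply: funext => f; rewrite /obs_defect !endoE (linearE_B _ _ lphi) !dinvK.
  lie_ring.
apply: raises_compl (raises_dinv phi).
apply: raisesB; last exact: raises_compl rMMb' (raises_diffeo phi).
by apply: raisesD => //; apply: raises_compr (raises_diffeo phi) rMMb.
Qed.

Let rX : raises p.+1 X := raises_obs_defect.
Let lX : linear X := raises_linear rX.

Lemma obs_defect_field : vector_field gr 1 X.
Proof.
apply: vector_fieldB (Cn_field_vector_field m').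
exact: vector_field_conj (Cn_field_vector_field m).
Qed.

Definition obs_field : L -> L := lead p.+1 X.
Local Notation O := obs_field.

Let rXO : raises p.+2 (X - O) := raises_sub_lead rX.
Let oO : endo_order p.+2 O := lead_order lX.

Lemma obs_field_cochain : harr_cochain gr p.+2 2 O.
Proof. by split=> //; apply: lead_vector_field_exact obs_defect_field. Qed.

(** Congruence here is up to maps raising the order by [p.+2], and an endomorphism homogeneous of
    order [p.+2] is determined by its class. *)
Lemma obs_fieldP xi :
  harr_cochain gr p.+2 2 xi /\ eqmod p.+3 xi X <-> xi = O.
Proof.
split=> [[[vxi oxi] /endo_eqmodP rxi]|->]; first exact: lead_unique.
split; first exact: obs_field_cochain.
by apply/endo_eqmodP; rewrite -opprB; apply: raisesN.
Qed.

(* (M' + X)^2 is the conjugate of M^2, so its leading term beyond M'^2 is the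
   anticommutator of A with the obstruction. *)
Lemma obs_field_closed : harr_diff A 2 O = 0.
Proof.
have -> : harr_diff A 2 O = (A \o O) + (O \o A).
  apply: funext => f; rewrite endoDE !endo_compE.
  rewrite -[LHS]/(A (O f) - (-1) ^+ 1 *: O (A f)).
  by rewrite expr1 scaleN1r opprK.
apply: (@raises_endo_order_eq0 _ _ p.+2).
  move=> j f fj; rewrite endoDE !endo_compE; apply: has_orderD.
    have := @sgc_mul_order _ _ _ A _ _ (oO fj).
    by congr has_order; lia.
  have := oO (@sgc_mul_order _ _ _ A _ _ fj).
  by congr has_order; lia.
(* The bound [2 * (p + 1) >= p + 3] is where [0 < p] enters. *)
have XX : raises p.+3 (X \o X).
  by apply: raises_leq (raises_comp rX rX); lia.
have rP2 : raises p.+3 ((phi \o (M \o M)) \o dinv phi).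
  apply: raises_compl (raises_dinv phi).
  exact: raises_compr (raises_diffeo phi) rM2.
(* The square of [M' + X] is expanded; putting [A] for [M'] and [O] for [X] in the cross terms costs
   only maps raising the order by [p.+3]. *)
have -> : (A \o O) + (O \o A) = ((phi \o (M \o M)) \o dinv phi) - (M' \o M')
   - (X \o X) - ((M' - sgc_mul A) \o X) - (A \o (X - O))
   - (X \o (M' - sgc_mul A)) - ((X - O) \o A).
  apply: funext => f.
  have PE g : phi (M (dinv phi g)) = M' g + X g.
    by rewrite /obs_defect endoBE !endo_compE; lie_ring.
  have P2 : ((phi \o (M \o M)) \o dinv phi) f = M' (M' f + X f) + X (M' f + X f).
    by rewrite !endo_compE -PE -PE dfunK.
  rewrite !endoBE P2 !endoE.
  rewrite (linearE_D _ _ lM') (linearE_D _ _ lX) (linearE_B _ _ lA).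
  by rewrite (linearE_B _ _ lX); lie_ring.
have r1 : raises p.+3 ((M' - sgc_mul A) \o X) := raises_comp rMA' rX.
have r2 : raises p.+3 (A \o (X - O)) := raises_comp rA rXO.
have r3 : raises p.+3 (X \o (M' - sgc_mul A)).
  by have := raises_comp rX rMA'; rewrite addn2.
have r4 : raises p.+3 ((X - O) \o A).
  by have := raises_comp rXO rA; rewrite addn1.
by do 6![apply: raisesB => //].
Qed.

Lemma obs_field_cocycle : O \in cocycle_pred A p.+2 2.
Proof.
by apply/asboolP; split; [apply: obs_field_cochain|apply: obs_field_closed].
Qed.

Definition obs_cocycle : harr_cocycle A p.+2 2 := HarrCocycle obs_field_cocycle.

Lemma harr_diff1E beta f : harr_diff A 1 beta f = A (beta f) - beta (A f).
Proof.
rewrite -[LHS]/(A (beta f) - (-1) ^+ 0 *: beta (A f)).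
by rewrite expr0 scale1r.
Qed.

Lemma endo_order_harr_diff beta :
  endo_order p.+1 beta -> endo_order p.+2 (harr_diff A 1 beta).
Proof.
move=> ob j f fj; rewrite harr_diff1E; apply: has_orderB.
  have := @sgc_mul_order _ _ _ A _ _ (ob _ _ fj).
  by congr has_order; lia.
have := ob _ _ (@sgc_mul_order _ _ _ A _ _ fj).
by congr has_order; lia.
Qed.

(* exp gamma = 1 + gamma modulo raises 2p, and p >= 1, so the order n part of
   exp(gamma) (M' + X) - M' exp(gamma) is the obstruction plus [gamma, A]. *)
Lemma extendableP : extendable phi <->
  exists2 gamma, harr_cochain gr p.+1 1 gamma & O = harr_diff A 1 gamma.
Proof.
have key gamma : harr_cochain gr p.+1 1 gamma -> forall psi : diffeo gr V,
    psi = lie_exp gamma \o phi :> (L -> L) ->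
    (Cn_morphism m m' psi <-> O = harr_diff A 1 gamma).
  move=> [vg og] psi psiE.
  have rg : raises p gamma.
    by apply: raises_endo_order => //; case: vg.
  have rg1 : raises 1 gamma := raises_leq p_gt0 rg.
  have lg := raises_linear rg.
  set e := lie_exp gamma in psiE.
  have re1 : raises 1 (e - id) := raises_lie_exp1 rg1.
  have re2 : raises p.+1 (e - id - gamma).
    by apply: raises_leq (raises_lie_exp2 rg1 rg); rewrite -addnn; lia.
  have ce : continuous_endo e := lie_exp_cont rg1.
  have [le _] := ce.
  have WE : (O - harr_diff A 1 gamma)
    = (((psi \o M) - (M' \o psi)) \o dinv phi)
      - (((e - id - gamma) \o M') - (M' \o (e - id - gamma)))
      - ((gamma \o (M' - sgc_mul A)) - ((M' - sgc_mul A) \o gamma))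
      - ((e - id) \o X) - (X - O).
    apply: funext => f; rewrite psiE !endoE harr_diff1E !dinvK.
    rewrite !(linearE_B _ _ lM') (linearE_B _ _ lg).
    have PE : phi (M (dinv phi f)) = M' f + X f.
      by rewrite /obs_defect endoBE !endo_compE; lie_ring.
    by rewrite PE (linearE_D _ _ le); lie_ring.
  have oW : endo_order p.+2 (O - harr_diff A 1 gamma).
    by apply: endo_orderB => //; apply: endo_order_harr_diff.
  have rest1 : raises p.+2
      (((e - id - gamma) \o M') - (M' \o (e - id - gamma))).
    apply: raisesB; last exact: raises_comp rM' re2.
    by have := raises_comp re2 rM'; rewrite addn1.
  have rest2 : raises p.+2
      ((gamma \o (M' - sgc_mul A)) - ((M' - sgc_mul A) \o gamma)).
    apply: raisesB; last exact: raises_comp rMA' rg.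
    by have := raises_comp rg rMA'; rewrite addn2.
  have rest3 : raises p.+2 ((e - id) \o X) := raises_comp re1 rX.
  split=> [/endo_eqmodP rZ|OE].
    apply/eqP; rewrite -subr_eq0; apply/eqP.
    apply: raises_endo_order_eq0 oW _; rewrite WE.
    have r0 := raises_compl rZ (raises_dinv phi).
    by do 4![apply: raisesB => //].
  apply/endo_eqmodP.
  have -> : (psi \o M) - (M' \o psi)
    = (((psi \o M) - (M' \o psi)) \o dinv phi) \o phi.
    by apply: funext => f; rewrite /= dfunK.
  apply: raises_compl (raises_diffeo phi).
  move: WE; rewrite OE subrr => /esym WE.
  set W := _ \o dinv phi in WE *.
  have sum0 (a b c d r : L -> L) : a - b - c - d - r = 0 -> a = b + c + d + r.
    move/eqP; rewrite -!addrA -!opprD subr_eq0 => /eqP ->.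
    by rewrite !addrA.
  rewrite (sum0 _ _ _ _ _ WE) -OE.
  exact: raisesD (raisesD (raisesD rest1 rest2) rest3) rXO.
split=> [[gamma [vg og [psi [psiE psiM]]]]|[gamma cg OE]].
  by exists gamma => //; apply/(key gamma _ psi).
have [vg og] := cg.
have rg : raises p gamma by apply: raises_endo_order => //; case: vg.
have rg1 : raises 1 gamma := raises_leq p_gt0 rg.
(* Since [gamma] raises the order by [p > 0], its exponential is unipotent and underlies a
   diffeomorphism. *)
have hE : lie_hom gr (lie_exp gamma) := lie_exp_hom vg rg1.
have [chi chiE] := unipotent_diffeo hE (raises_lie_exp1 rg1).
have [psi psiE] : exists psi : diffeo gr V, psi = chi \o phi :> (L -> L).
  have hd := lie_hom_comp (dfun_hom chi) (dfun_hom phi).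
  have hi := lie_hom_comp (dinv_hom phi) (dinv_hom chi).
  have K1 : cancel (chi \o phi) (dinv phi \o dinv chi).
    by move=> f; rewrite /= !dfunK.
  have K2 : cancel (dinv phi \o dinv chi) (chi \o phi).
    by move=> f; rewrite /= !dinvK.
  by exists (Diffeo hd hi K1 K2).
exists gamma; split=> //; exists psi; split; first by rewrite psiE chiE.
by apply/(key gamma cg psi); rewrite // psiE chiE.
Qed.

End OneMorphism.

(** The witness [beta] is the component of order [p.+1] of [H], the difference between
    [dinv phi' \o phi] and the exponential [e] of the homotopy. *)
Lemma obs_homotopic (phi phi' : pointed_morphism (Cn_trunc m) (Cn_trunc m')) :
  homotopic phi phi' -> exists2 beta, harr_cochain gr p.+1 1 beta &
    obs_field phi' - obs_field phi = harr_diff A 1 beta.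
Proof.
move=> [eta [veta /endo_eqmodP rpe]].
have rphi := raises_pointed (pm_pointed phi).
have rphi' := raises_pointed (pm_pointed phi').
have reta := raises_vector_field veta; have leta := raises_linear reta.
set D := commutator 1 (-1) _ eta in rpe.
have vD : vector_field gr 0 D.
  exact: vector_field_commutator (Cn_field_vector_field _) veta.
have DE f : D f = Mb (eta f) + eta (Mb f) by rewrite /D commutatorE.
have rD : raises 1 D.
  have -> : D = (Mb \o eta) + (eta \o Mb) by apply: funext.
  by apply: raisesD; [exact: raises_compl rMb reta|exact: raises_compr reta rMb].
set e := lie_exp D in rpe.
have re1 : raises 1 (e - id) := raises_lie_exp1 rD.
have [ce de be] : lie_hom gr e := lie_exp_hom vD rD.
have [le _] := ce; have [lMb lD] := (raises_linear rMb, raises_linear rD).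
(* The commutator of [D] and [M] reduces to those of [eta] with [Mb \o Mb] and of [D] with [M - Mb].
   Both raise the order by [p.+2], and the exponential inherits the bound. *)
have reM : raises p.+2 ((e \o M) - (M \o e)).
  apply: lie_exp_commute => //; first exact: raises_leq rM.
  have -> : (D \o M) - (M \o D) = (eta \o (Mb \o Mb)) - ((Mb \o Mb) \o eta)
      + (D \o (M - Mb)) - ((M - Mb) \o D).
    apply: funext => f; rewrite !endoE (linearE_B _ _ lD) !DE.
    by rewrite (linearE_D _ _ lMb); lie_ring.
  apply: raisesB; last by have := raises_comp rMMb rD; rewrite addn1.
  apply: raisesD; last exact: raises_comp rD rMMb.
  by apply: raisesB; [exact: raises_compr reta rMb2|exact: raises_compl rMb2 reta].
pose U := dinv phi' \o phi.
have ld := raises_linear (raises_dinv phi').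
have lp' := raises_linear (raises_diffeo phi').
have lp := raises_linear (raises_diffeo phi).
pose H := U - e.
have rH : raises p H.
  have -> : H = dinv phi' \o (dfun phi - (phi' \o e)).
    by apply: funext => f; rewrite !endoE (linearE_B _ _ ld) dfunK.
  exact: raises_compr (raises_dinv phi') rpe.
have lH := raises_linear rH.
have rU1 : raises 1 (U - id).
  have -> : U - id = dinv phi' \o ((dfun phi - id) - (dfun phi' - id)).
    apply: funext => f; rewrite !endoE.
    have -> : phi f - f - (phi' f - f) = phi f - phi' f by lie_ring.
    by rewrite (linearE_B _ _ ld) dfunK.
  by apply: raises_compr (raises_dinv phi') _; apply: raisesB.
have [_ dU bU] : lie_hom gr U := lie_hom_comp (dinv_hom phi') (dfun_hom phi).
(* Here [H [f, g] = [H f, U g] + [e f, H g]], and [U] and [e] are the identity up to higher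
   order. *)
have vb : vector_field gr 0 (lead p H).
  apply: lead_vector_field => //; first exact: endo_degreeB.
  move=> d a b f g _ fa gb.
  have [fa1 gb1] := (has_order_ge (leqnn a) fa, has_order_ge (leqnn b) gb).
  have [[[_ RH] [_ RU]] [_ Re]] := (rH, rU1, re1).
  have o1 := order_ge_bracket (RH _ _ fa1) (RU _ _ gb1).
  have o2 := order_ge_bracket (Re _ _ fa1) (RH _ _ gb1).
  have e1 : (a + p + (b + 1))%N = (a + b + p).+1 by lia.
  have e2 : (a + 1 + (b + p))%N = (a + b + p).+1 by lia.
  rewrite e1 in o1; rewrite e2 in o2.
  rewrite mul0r expr0 scale1r; move: (order_geD o1 o2).
  rewrite /H !endoE bU be !lie_bracketBl !lie_bracketBr.
  by congr order_ge; lie_ring.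
exists (lead p H); first by split=> //; apply: lead_order lH.
apply/eqP; rewrite -subr_eq0; apply/eqP.
have rb := raises_sub_lead rH; have rlb := raises_lead rH.
have lb := raises_linear rlb.
apply: (@raises_endo_order_eq0 _ _ p.+1).
  apply: endo_orderB; last by apply: endo_order_harr_diff; apply: lead_order lH.
  by apply: endo_orderB; apply: lead_order;
    apply: raises_linear (raises_obs_defect _).
pose Y := (H \o M) - (M \o H).
have rY : raises p.+1 Y.
  apply: raisesB; last exact: raises_comp rM rH.
  by have := raises_comp rH rM; rewrite addn1.
have lY := raises_linear rY.
(* The two defects differ by [U M - M U], composed with [phi'] on the left and [dinv phi] on the
   right. With [U = e + H] the part of [e] is negligible; in the part of [H] the outer maps are
   replaced by the identity, [H] by its component and [M] by [A]. Each correction raises the order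
   by [p.+2]. *)
have -> : (obs_field phi' - obs_field phi) - harr_diff A 1 (lead p H)
  = (obs_defect phi - obs_field phi) - (obs_defect phi' - obs_field phi')
    - (phi' \o ((e \o M) - (M \o e)) \o dinv phi)
    - ((dfun phi' - id) \o (Y \o dinv phi)) - (Y \o (dinv phi - id))
    - ((H - lead p H) \o M) + (M \o (H - lead p H))
    - (lead p H \o (M - sgc_mul A)) + ((M - sgc_mul A) \o lead p H).
  apply: funext => f; rewrite !endoE harr_diff1E.
  rewrite (linearE_B _ _ lY) (linearE_B _ _ lb) (linearE_B _ _ lM).
  have -> : obs_defect phi f - obs_field phi f
      - (obs_defect phi' f - obs_field phi' f)
     = obs_field phi' f - obs_field phi f
       + phi' (U (M (dinv phi f)) - M (U (dinv phi f))).
    rewrite (linearE_B _ _ lp') /U !endo_compE !dinvK /obs_defect !endoE.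
    lie_ring.
  have -> : U (M (dinv phi f)) - M (U (dinv phi f))
    = (e (M (dinv phi f)) - M (e (dinv phi f))) + Y (dinv phi f).
    by rewrite /Y /H !endoE (linearE_B _ _ lM); lie_ring.
  by rewrite (linearE_D _ _ lp') /Y !endoE; lie_ring.
have rXO psi : raises p.+2 (obs_defect psi - obs_field psi).
  exact: raises_sub_lead (raises_obs_defect psi).
apply: raisesD; last exact: raises_comp rMA rlb.
apply: raisesB; last by have := raises_comp rlb rMA; rewrite addn2.
apply: raisesD; last exact: raises_comp rM rb.
apply: raisesB; last by have := raises_comp rb rM; rewrite addn1.
apply: raisesB.
  apply: raisesB; last first.
    exact: raises_comp rphi' (raises_compl rY (raises_dinv phi)).
  apply: raisesB; first by apply: raisesB.
  apply: raises_compl (raises_dinv phi).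
  exact: raises_compr (raises_diffeo phi') reM.
by have := raises_comp rY (raises_dinv_pointed rphi); rewrite addn1.
Qed.

Lemma harr_class_eq0 i j (xi : harr_cocycle A i j) :
  harr_class xi = 0 <-> exists2 beta, harr_cochain gr i.-1 (j - 1) beta
                  & (xi : L -> L) = harr_diff A (j - 1) beta.
Proof.
have -> : (0 : harr_cohomology A i j) = harr_class 0.
  by rewrite /harr_class raddf0.
rewrite /harr_class; split=> [/eqP|H].
  by rewrite -Quotient.idealrBE subr0 => /asboolP.
by apply/eqP; rewrite -Quotient.idealrBE subr0; apply/asboolP.
Qed.

End Obstruction.

Theorem theorem9p19 (K : comAlgType rat) (gr : even_grading K)
    (V : free_graded) (A : sgc_algebra gr V) (n : nat) (hn : (3 <= n)%N)
    (m m' : Cn_structure gr V n.+1)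
    (hm : has_underlying_algebra m A) (hm' : has_underlying_algebra m' A) :
  exists (obs : pointed_morphism (Cn_trunc m) (Cn_trunc m') ->
                harr_cocycle A n 2)
         (obs_n : moduli (Cn_trunc m) (Cn_trunc m') -> harr_cohomology A n 2),
    [/\ (* obs phi is the vector field of order n and degree one given by
           phi m phi^-1 - m' modulo (n + 1) *)
        forall (phi : pointed_morphism (Cn_trunc m) (Cn_trunc m'))
               (xi : lie K V -> lie K V),
          (harr_cochain gr n 2 xi /\
           eqmod n.+1 xi (phi \o Cn_field m \o dinv phi - Cn_field m')) <->
          xi = obs phi,
        forall phi, obs_n (moduli_class phi) = harr_class (obs phi),
        forall phi, extendable phi <-> obs_n (moduli_class phi) = 0 &
        [set x | exists phi, x = moduli_class phi /\ extendable phi]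
        = obs_n @^-1` [set 0]].
Proof.
case: n hn m m' hm hm' => [|[|p]] // p_gt0 m m' hm hm'.
pose obs phi := obs_cocycle p_gt0 hm hm' phi.
(* The class is evaluated at a chosen representative; [class_rel] shows that the choice does not
   matter. *)
pose obs_n (x : moduli (Cn_trunc m) (Cn_trunc m')) := harr_class (obs (repr x)).
have homot phi phi' : homotopic phi phi' ->
    harr_class (obs phi') = harr_class (obs phi).
  move=> /(obs_homotopic p_gt0 hm) [beta cb bE].
  apply/eqP; rewrite -Quotient.idealrBE; apply/asboolP.
  by exists beta.
(* Equality of cohomology classes is an equivalence relation, so invariance under one homotopy
   passes to the relation generated. *)
have class_rel phi phi' :
    Relation_Operators.clos_refl_sym_trans _ 
      (@homotopic _ _ _ _ _ _) phi phi' ->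
    harr_class (obs phi) = harr_class (obs phi').
  by elim=> {phi phi'} [x y /homot|//|x y _ ->|x y z _ -> _ ->].
have obs_nE phi : obs_n (moduli_class phi) = harr_class (obs phi).
  apply: class_rel; apply/asboolP.
  have : moduli_class (repr (moduli_class phi)) = moduli_class phi := reprK _.
  by move/eqmodP.
have ext phi : extendable phi <-> obs_n (moduli_class phi) = 0.
  rewrite obs_nE; have e1 := extendableP p_gt0 hm' phi.
  by have e2 := harr_class_eq0 (obs phi); split=> [/e1 /e2|/e2 /e1].
exists obs, obs_n; split=> //; first by move=> phi xi; apply: obs_fieldP.
apply/seteqP; split=> x /=; first by case=> phi [-> /ext].
(* By [ext] extendability depends only on the class, so the chosen representative is a witness. *)
move=> x0; exists (repr x); rewrite /moduli_class reprK; split=> //.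
by apply/ext; rewrite /moduli_class reprK.
Qed.
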